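(* Let $d,s\ge2$, $\rho\in(0,1)$, and let $\mu_X$ be a Borel probability measure on $\mathbb{R}^d$ with a $C^1$ density and compact support. Let $X_1,X_2,\dots$ be i.i.d. with law $\mu_X$, and let $\mu^*$ be a probability measure on $\mathbb{R}^d\times\mathbb{R}^s$ such that for some subsequence $n_k$, $\mu_{n_k}$ converges weakly to $\mu^*$ and $I_\rho(\mu^* )=\inf_{\mu\in\widetilde{\mathcal P}_X}I_\rho(\mu)$. Then $\mu^*$ has compact support.
   Context: t-SNE: For $n\ge2$ and $X_1,\dots,X_n\in\mathbb{R}^d$, choose $\sigma_i>0$ with $-\sum_{j\neq i}p_{j|i}\log p_{j|i}=\log(n\rho)$, where $p_{j|i}=\exp(-\|X_i-X_j\|^2/2\sigma_i^2)/\sum_{k\neq i}\exp(-\|X_i-X_k\|^2/2\sigma_i^2)$. Set $p_{ij}=(p_{i|j}+p_{j|i})/(2n)$ ($i\ne j$), $p_{ii}=0$; for $Y\in(\mathbb{R}^s)^n$, $q_{ij}=(1+\|Y_i-Y_j\|^2)^{-1}/\sum_{k\neq\ell}(1+\|Y_k-Y_\ell\|^2)^{-1}$ ($i\ne j$), $q_{ii}=0$, $L_{n,\rho}(X,Y)=\sum_{i\neq j}p_{ij}\log(p_{ij}/q_{ij})$. $Y^*$ is a minimizer of $L_{n,\rho}(X,\cdot)$ and $\mu_n=\frac1n\sum_i\delta_{(X_i,Y_i^* )}$. Limit objects: For a probability measure $\mu$ on $\mathbb{R}^d\times\mathbb{R}^s$, $w_{x,\sigma}(x')=\exp(-\|x-x'\|^2/2\sigma^2)/\int\exp(-\|x-z\|^2/2\sigma^2)d\mu(z)$,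 $F_{\rho,\mu}(x,\sigma)=\int w_{x,\sigma}\log w_{x,\sigma}\,d\mu(x')+\log\rho$, $\sigma^*_{\rho,\mu}(x)$ the unique $\sigma>0$ with $F_{\rho,\mu}(x,\sigma)=0$; $p_\psi(x,x')=\frac12\Big(\frac{e^{-\|x-x'\|^2/2\psi(x)^2}}{\int e^{-\|x-z\|^2/2\psi(x)^2}d\mu(z)}+\frac{e^{-\|x-x'\|^2/2\psi(x')^2}}{\int e^{-\|z-x'\|^2/2\psi(x')^2}d\mu(z)}\Big)$; $q(y,y')=(1+\|y-y'\|^2)^{-1}/\iint(1+\|u-u'\|^2)^{-1}d\mu d\mu$; $I_\rho(\mu)=\iint p_{\sigma^*_{\rho,\mu}}\log(p_{\sigma^*_{\rho,\mu}}/q)\,d\mu\,d\mu$. $\mathcal P_X$ = probability measures on $\mathbb{R}^d\times\mathbb{R}^s$ with $\mathbb{R}^d$-marginal $\mu_X$; $\widetilde{\mathcal P}_X$ = those $\mu\in\mathcal P_X$ with $\int(p(x,x')-q(y,y'))\frac{y-y'}{1+\|y-y'\|^2}d\mu(x',y')=0$ for $\mu$-a.e. $(x,y)$, with $p=p_{\sigma^*_{\rho,\mu}}$, $q$ computed from $\mu$. *)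

(* Defs.v *)
From HB Require Import structures.
From mathcomp Require Import all_boot all_order all_algebra.
From mathcomp Require Import all_classical all_reals all_analysis.
Set Implicit Arguments. Unset Strict Implicit. Unset Printing Implicit Defensive.
Import Order.TTheory GRing.Theory Num.Theory.
Import numFieldNormedType.Exports.
Local Open Scope classical_set_scope.
Local Open Scope ring_scope.

HB.instance Definition _ (T U : ptopologicalType) := Pointed.on (T * U)%type.

Definition borel_type (T : ptopologicalType) := g_sigma_algebraType (@open T).

Definition sqn (R : realType) (k : nat) (x y : 'rV[R]_k) : R :=
  \sum_(i < k) (x 0 i - y 0 i) ^+ 2.

Definition gk (R : realType) (d : nat) (sig : R) (x x' : 'rV[R]_d) : R :=
  expR (- sqn x x' / (2 * sig ^+ 2)).

Definition pcond (R : realType) (d n : nat) (X : 'I_n -> 'rV[R]_d)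
    (sig : 'I_n -> R) (i j : 'I_n) : R :=
  if i == j then 0
  else gk (sig i) (X i) (X j) / \sum_(k < n | k != i) gk (sig i) (X i) (X k).

Definition calibrated (R : realType) (d n : nat) (rho : R)
    (X : 'I_n -> 'rV[R]_d) (sig : 'I_n -> R) : Prop :=
  forall i : 'I_n, 0 < sig i /\
    - (\sum_(j < n | j != i) pcond X sig i j * ln (pcond X sig i j))
    = ln (n%:R * rho).

Definition pjoint (R : realType) (d n : nat) (X : 'I_n -> 'rV[R]_d)
    (sig : 'I_n -> R) (i j : 'I_n) : R :=
  if i == j then 0 else (pcond X sig j i + pcond X sig i j) / (2 * n%:R).

Definition qjoint (R : realType) (s n : nat) (Y : 'I_n -> 'rV[R]_s)
    (i j : 'I_n) : R :=
  if i == j then 0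
  else (1 + sqn (Y i) (Y j))^-1 /
       \sum_(k < n) \sum_(l < n | l != k) (1 + sqn (Y k) (Y l))^-1.

Definition tsne_loss (R : realType) (d s n : nat) (X : 'I_n -> 'rV[R]_d)
    (sig : 'I_n -> R) (Y : 'I_n -> 'rV[R]_s) : R :=
  \sum_(i < n) \sum_(j < n | j != i)
     pjoint X sig i j * ln (pjoint X sig i j / qjoint Y i j).

Definition is_tsne_minimizer (R : realType) (d s n : nat)
    (X : 'I_n -> 'rV[R]_d) (sig : 'I_n -> R) (Y : 'I_n -> 'rV[R]_s) : Prop :=
  forall Y' : 'I_n -> 'rV[R]_s, tsne_loss X sig Y <= tsne_loss X sig Y'.

Definition empirical (R : realType) (T : ptopologicalType) (n : nat)
    (Z : nat -> borel_type T) : {measure set (borel_type T) -> \bar R} :=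
  mscale ((n%:R)^-1)%:nng (msum (fun i => @dirac _ (borel_type T) (Z i) R) n).

Definition weak_cvg (R : realType) (T : ptopologicalType)
    (mus : nat -> {measure set (borel_type T) -> \bar R})
    (mu : {measure set (borel_type T) -> \bar R}) : Prop :=
  forall f : T -> R, continuous f -> (exists M : R, forall z, `|f z| <= M) ->
    (fun k => (\int[mus k]_z (f z)%:E)%E) @ \oo
      --> (\int[mu]_z (f z)%:E)%E.

Definition msupport (R : realType) (T : ptopologicalType)
    (mu : set (borel_type T) -> \bar R) : set T :=
  [set z | forall U : set T, open U -> U z -> (0 < mu U)%E].

Definition mutually_independent d (Omega : measurableType d) (R : realType)
    (P : probability Omega R) (T : ptopologicalType)
    (X : nat -> Omega -> borel_type T) : Prop :=
  forall (I : seq nat) (A : nat -> set (borel_type T)), uniq I ->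
    (forall i, i \in I -> measurable (A i)) ->
    P (\big[setI/setT]_(i <- I) (X i @^-1` A i)) =
    (\prod_(i <- I) P (X i @^-1` A i))%E.

Fixpoint lebint (R : realType) (d : nat) : ('rV[R]_d -> \bar R) -> \bar R :=
  match d return ('rV[R]_d -> \bar R) -> \bar R with
  | 0 => fun f => f 0
  | d'.+1 => fun f =>
      (\int[@lebesgue_measure R]_t
         lebint (fun v : 'rV[R]_d' => f (row_mx (const_mx t : 'rV[R]_1) v)))%E
  end.

Definition has_density (R : realType) (d : nat)
    (mu : set (borel_type 'rV[R]_d) -> \bar R) (f : 'rV[R]_d -> R) : Prop :=
  (forall x, 0 <= f x) /\
  forall A : set (borel_type 'rV[R]_d), measurable A ->
    mu A = lebint (fun x => (\1_A x * f x)%:E).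

Definition C1 (R : realType) (d : nat) (f : 'rV[R]_d -> R) : Prop :=
  forall i : 'I_d,
    (forall x, derivable f x (delta_mx 0 i)) /\
    continuous (fun x => 'D_(delta_mx 0 i) f x).

Definition BT (R : realType) (d s : nat) := borel_type ('rV[R]_d * 'rV[R]_s)%type.

Definition wfun (R : realType) (d s : nat) (mu : probability (BT R d s) R)
    (sig : R) (x x' : 'rV[R]_d) : R :=
  gk sig x x' / Rintegral mu setT (fun z : BT R d s => gk sig x z.1).

Definition Ffun (R : realType) (d s : nat) (rho : R)
    (mu : probability (BT R d s) R) (x : 'rV[R]_d) (sig : R) : R :=
  Rintegral mu setT (fun z : BT R d s => wfun mu sig x z.1 * ln (wfun mu sig x z.1))
  + ln rho.

Definition sigstar (R : realType) (d s : nat) (rho : R)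
    (mu : probability (BT R d s) R) (x : 'rV[R]_d) : R :=
  xget 1 [set sig : R | 0 < sig /\ Ffun rho mu x sig = 0].

Definition pfun (R : realType) (d s : nat) (rho : R)
    (mu : probability (BT R d s) R) (x x' : 'rV[R]_d) : R :=
  (wfun mu (sigstar rho mu x) x x' + wfun mu (sigstar rho mu x') x' x) / 2.

Definition Zq (R : realType) (d s : nat) (mu : probability (BT R d s) R) : R :=
  Rintegral mu setT (fun u : BT R d s =>
    Rintegral mu setT (fun u' : BT R d s => (1 + sqn u.2 u'.2)^-1)).

Definition qfun (R : realType) (d s : nat) (mu : probability (BT R d s) R)
    (y y' : 'rV[R]_s) : R :=
  (1 + sqn y y')^-1 / Zq mu.

Definition Irho (R : realType) (d s : nat) (rho : R)
    (mu : probability (BT R d s) R) : \bar R :=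
  (\int[mu]_z \int[mu]_z'
     (pfun rho mu z.1 z'.1 * ln (pfun rho mu z.1 z'.1 / qfun mu z.2 z'.2))%:E)%E.

Definition in_PX (R : realType) (d s : nat)
    (muX : probability (borel_type 'rV[R]_d) R)
    (mu : probability (BT R d s) R) : Prop :=
  forall A : set (borel_type 'rV[R]_d), measurable A ->
    mu (A `*` setT) = muX A.

(** tilde P_X : stationarity condition holds mu-a.e. (componentwise). *)
Definition in_PtX (R : realType) (d s : nat) (rho : R)
    (muX : probability (borel_type 'rV[R]_d) R)
    (mu : probability (BT R d s) R) : Prop :=
  in_PX muX mu /\
  {ae mu, forall z : BT R d s, forall j : 'I_s,
     (\int[mu]_z'
       ((pfun rho mu z.1 z'.1 - qfun mu z.2 z'.2) * (z.2 0 j - z'.2 0 j)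
          / (1 + sqn z.2 z'.2))%:E = 0)%E}.

(* Main.v *)
Require Import Defs.
From HB Require Import structures.
From mathcomp Require Import all_boot all_order all_algebra.
From mathcomp Require Import all_classical all_reals all_analysis.
From mathcomp Require Import measurable_realfun ring lra.
Set Implicit Arguments.
Unset Strict Implicit.
Unset Printing Implicit Defensive.
Import Order.TTheory GRing.Theory Num.Theory.
Import numFieldNormedType.Exports.
Local Open Scope classical_set_scope.
Local Open Scope ring_scope.

(** Minimality of the finite embeddings alone keeps the points [Y_i] in a ball
    that does not depend on [n].  Write [N_i = |Y_i|^2], [D_ij = |Y_i - Y_j|^2]
    and let [tail T] be the fraction of points with [T <= N_i].  At a minimizer
    the derivative of the loss along every displacement [h] vanishes, that is,
    [sum (p_ij - q_ij) <Y_i - Y_j, h_i - h_j> / (1 + D_ij) = 0]; we test this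
    with radial displacements [h_i = phi (N_i) Y_i], [phi] nondecreasing, for
    which all the scalar products are nonnegative.

    Near a point of the support of the limit there is a positive fraction of
    anchors: points with bounded [Y_j] whose bandwidths are bounded below,
    because the law of the data has no atoms and the entropy calibration thus
    prevents the kernels from concentrating.  Anchors attract every other point,
    [p_ij >= c / n^2], so the mean of [phi (N_i)] is bounded by the repulsion,
    which is small unless [Y_i] and [Y_j] are both far out.  With
    [phi x = (1 - T / x)^+] this gives
    [tail (4 T) <= K tail T (tail (T / 4) + 1 / T)], and tightness of the weakly
    convergent sequence starts the recursion: [tail T = O(T^-2)] uniformly in
    [n].  Taking for [phi] the indicator of the outermost points, at radius
    [M = max_i N_i], gives [1 <= K ((M + 3) tail (M / 4) + 28 / M)], hence a
    bound on [M]. *)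

Section SquaredDistance.
Context {R : realType} {k : nat}.
Implicit Types x y z u v : 'rV[R]_k.

Lemma sqn_ge0 x y : 0 <= sqn x y.
Proof. by apply: sumr_ge0 => i _; exact: sqr_ge0. Qed.

Lemma sqnC x y : sqn x y = sqn y x.
Proof. by apply: eq_bigr => i _; rewrite -sqrrN opprB. Qed.

Lemma sqnn x : sqn x x = 0.
Proof. by apply: big1 => i _; rewrite subrr expr0n. Qed.

Lemma one_sqn_gt0 x y : 0 < 1 + sqn x y.
Proof. by rewrite ltr_wpDr ?sqn_ge0. Qed.

Lemma coord_sqr_le_sqn x y i : (x 0 i - y 0 i) ^+ 2 <= sqn x y.
Proof.
by rewrite /sqn (bigD1 i)//= lerDl sumr_ge0// => j _; exact: sqr_ge0.
Qed.

Lemma sqn_le2 x y z : sqn x z <= 2 * sqn x y + 2 * sqn y z.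
Proof.
rewrite /sqn !mulr_sumr -big_split /=; apply: ler_sum => i _.
have := sqr_ge0 (x 0 i - y 0 i - (y 0 i - z 0 i)); nra.
Qed.

Definition dotp x y : R := \sum_(i < k) x 0 i * y 0 i.

Lemma sqn_perturb (t : R) x y u v :
  sqn (x - t *: u) (y - t *: v) =
  sqn x y - 2 * t * dotp (x - y) (u - v) + t ^+ 2 * sqn u v.
Proof.
rewrite /dotp /sqn !mulr_sumr -sumrN -!big_split /=.
by apply: eq_bigr => i _; rewrite !mxE; ring.
Qed.

Lemma dotp_scale_diff (l m : R) x y :
  dotp (x - y) (l *: x - m *: y) =
  ((l - m) * (sqn x 0 - sqn y 0) + (l + m) * sqn x y) / 2.
Proof.
rewrite /dotp /sqn -sumrB !mulr_sumr -big_split /= mulr_suml.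
by apply: eq_bigr => i _; rewrite !mxE; field.
Qed.

Lemma dotp_cauchy_schwarz x y : dotp x y ^+ 2 <= sqn x 0 * sqn y 0.
Proof.
pose p := Poly [:: sqn x 0; - (2 * dotp x y); sqn y 0].
have : p`_1 ^+ 2 - 4 * p`_2 * p`_0 <= 0.
  apply: deg_le2_poly_ge0 => [|t]; first exact: size_Poly.
  rewrite horner_Poly /=; have := sqn_ge0 (x - t *: y) (0 - t *: 0).
  by rewrite sqn_perturb !subr0; lra.
by rewrite !coefE /=; lra.
Qed.

Lemma sqn_sub_sqr_le x y :
  (sqn x 0 - sqn y 0) ^+ 2 <= 2 * (sqn x 0 + sqn y 0) * sqn x y.
Proof.
have diffE : sqn x 0 - sqn y 0 = dotp (x - y) (x + y).
  by rewrite /sqn -sumrB; apply: eq_bigr => i _; rewrite !mxE; ring.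
have sub0 : sqn (x - y) 0 = sqn x y.
  by apply: eq_bigr => i _; rewrite !mxE subr0.
have add_le : sqn (x + y) 0 <= 2 * (sqn x 0 + sqn y 0).
  rewrite mulrDr {1}/sqn !mulr_sumr -big_split /=; apply: ler_sum => i _.
  by rewrite !mxE !subr0; have := sqr_ge0 (x 0 i - y 0 i); lra.
rewrite diffE (le_trans (dotp_cauchy_schwarz _ _))// sub0 mulrC.
by rewrite ler_wpM2r ?sqn_ge0.
Qed.

End SquaredDistance.

Section DerivativeRules.
Context {R : realType}.

Lemma is_derive_sumr (I : Type) (r : seq I) (A : pred I) (f : I -> R -> R)
    (df : I -> R) (t : R) :
  (forall i, is_derive t (1 : R) (f i) (df i)) ->
  is_derive t (1 : R) (fun u => \sum_(i <- r | A i) f i u)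
    (\sum_(i <- r | A i) df i).
Proof.
move=> dfi; rewrite (_ : (fun u => _) = \sum_(i <- r | A i) f i); last first.
  by apply/funext => u; rewrite fct_sumE.
by elim/big_ind2 : _ => // *; [exact: is_derive_cst|exact: is_deriveD].
Qed.

Lemma is_derive_ln_comp (f : R -> R) (t a : R) : 0 < f t ->
  is_derive t (1 : R) f a -> is_derive t (1 : R) (fun u => ln (f u)) (a / f t).
Proof.
by move=> f0 df; rewrite mulrC; apply: is_derive1_comp; exact: is_derive1_ln.
Qed.

End DerivativeRules.

Section Stationarity.
Context {R : realType} {d s n : nat}.
Implicit Types (X : 'I_n -> 'rV[R]_d) (sig : 'I_n -> R).
Implicit Types Y h : 'I_n -> 'rV[R]_s.

Definition qnorm Y : R :=
  \sum_(k < n) \sum_(l < n | l != k) (1 + sqn (Y k) (Y l))^-1.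

Lemma sumr_neq_gt0 (F : 'I_n -> R) (i : 'I_n) :
  (2 <= n)%N -> (forall j, 0 < F j) -> 0 < \sum_(j < n | j != i) F j.
Proof.
move=> n2 F0; have /card_gt0P[j] : (0 < #|predC1 i|)%N.
  by rewrite cardC1 card_ord -subn1 subn_gt0.
rewrite inE => ji; rewrite (bigD1 j) //= ltr_wpDr ?F0 // sumr_ge0 // => l _.
exact: ltW.
Qed.

Lemma qnorm_gt0 Y : (2 <= n)%N -> 0 < qnorm Y.
Proof.
move=> n2; rewrite /qnorm (bigD1 (Ordinal n2)) //= ltr_wpDr //.
  by do 2!apply: sumr_ge0 => ? _; rewrite invr_ge0 ltW// one_sqn_gt0.
by apply: sumr_neq_gt0 => // j; rewrite invr_gt0 one_sqn_gt0.
Qed.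

Lemma qjointE Y i j :
  i != j -> qjoint Y i j = (1 + sqn (Y i) (Y j))^-1 / qnorm Y.
Proof. by rewrite /qjoint => /negbTE ->. Qed.

Lemma ord_neq_gt1 (i j : 'I_n) : i != j -> (2 <= n)%N.
Proof.
by move=> ij; have := max_card [set i; j]%SET; rewrite cards2 ij card_ord.
Qed.

Lemma pcond_gt0 X sig i j : i != j -> 0 < pcond X sig i j.
Proof.
move=> ij; rewrite /pcond (negbTE ij) divr_gt0 ?expR_gt0//.
by apply: sumr_neq_gt0 => [|l]; [exact: ord_neq_gt1 ij|exact: expR_gt0].
Qed.

Lemma pcond_ge0 X sig i j : 0 <= pcond X sig i j.
Proof.
by have [->|/pcond_gt0/ltW//] := eqVneq i j; rewrite /pcond eqxx.
Qed.

Lemma sum_pcond X sig i : (2 <= n)%N -> \sum_(j < n) pcond X sig i j = 1.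
Proof.
move=> n2; have S0 : 0 < \sum_(l < n | l != i) gk (sig i) (X i) (X l).
  by apply: sumr_neq_gt0 => // l; exact: expR_gt0.
rewrite -(divff (lt0r_neq0 S0)) mulr_suml (bigD1 i) //= /pcond eqxx add0r.
by apply: eq_bigr => j; rewrite eq_sym => /negbTE ->.
Qed.

Lemma pjoint_diag X sig i : pjoint X sig i i = 0.
Proof. by rewrite /pjoint eqxx. Qed.

Lemma pjointE X sig i j :
  pjoint X sig i j = (pcond X sig j i + pcond X sig i j) / (2 * n%:R).
Proof.
rewrite /pjoint; case: eqP => // ->.
by rewrite /pcond eqxx addr0 mul0r.
Qed.

Lemma pjoint_ge0 X sig i j : 0 <= pjoint X sig i j.
Proof. by rewrite pjointE divr_ge0 ?addr_ge0 ?pcond_ge0// mulr_ge0. Qed.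

Lemma sum_pjoint X sig : (2 <= n)%N ->
  \sum_(i < n) \sum_(j < n) pjoint X sig i j = 1.
Proof.
move=> n2; have n0 : n%:R != 0 :> R by rewrite pnatr_eq0 -lt0n ltnW.
have total : \sum_(i < n) \sum_(j < n) pcond X sig i j = n%:R.
  rewrite (eq_bigr (fun=> 1)) ?sumr_const ?card_ord// => i _.
  exact: sum_pcond.
under eq_bigr do under eq_bigr do rewrite pjointE.
under eq_bigr do rewrite -mulr_suml big_split /=.
rewrite -mulr_suml big_split /= [X in X + _]exchange_big /= total.
by field.
Qed.

Lemma tsne_lossE X sig Y : (2 <= n)%N -> tsne_loss X sig Y =
  \sum_(i < n) \sum_(j < n) pjoint X sig i j * ln (pjoint X sig i j)
  + \sum_(i < n) \sum_(j < n) pjoint X sig i j * ln (1 + sqn (Y i) (Y j))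
  + ln (qnorm Y).
Proof.
move=> n2.
have -> : ln (qnorm Y) =
    (\sum_(i < n) \sum_(j < n) pjoint X sig i j) * ln (qnorm Y).
  by rewrite sum_pjoint// mul1r.
rewrite mulr_suml -!big_split /=; apply: eq_bigr => i _.
rewrite mulr_suml -!big_split /= [RHS](bigD1 i) //= pjoint_diag.
rewrite !mul0r !addr0 add0r; apply: eq_bigr => j ji.
have p0 : 0 < pjoint X sig i j.
  rewrite pjointE divr_gt0 ?addr_gt0 ?pcond_gt0// 1?eq_sym//.
  by rewrite mulr_gt0// ltr0n ltnW.
have D0 := one_sqn_gt0 (Y i) (Y j); have Z0 := qnorm_gt0 Y n2.
rewrite qjointE 1?eq_sym// ln_div ?posrE ?divr_gt0 ?invr_gt0//.
by rewrite ln_div ?posrE ?invr_gt0// lnV ?posrE//; ring.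
Qed.

Definition shifted Y h (t : R) (i : 'I_n) : 'rV[R]_s := Y i - t *: h i.

Definition virial (w : 'I_n -> 'I_n -> R) Y h : R :=
  \sum_(i < n) \sum_(j < n)
    w i j * (dotp (Y i - Y j) (h i - h j) / (1 + sqn (Y i) (Y j))).

Lemma is_derive_sqn_shifted Y h i j (t : R) :
  is_derive t (1 : R) (fun u => 1 + sqn (shifted Y h u i) (shifted Y h u j))
    (- 2 * dotp (shifted Y h t i - shifted Y h t j) (h i - h j)).
Proof.
set E := dotp (Y i - Y j) (h i - h j); set F := sqn (h i) (h j).
rewrite (_ : (fun u => _) = fun u : R =>
    (1 + sqn (Y i) (Y j)) + ((- (2 * E)) *: u + F *: u ^+ 2)); last first.
  by apply/funext => u; rewrite sqn_perturb -/E -/F /GRing.scale /=; ring.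
apply: is_derive_eq.
rewrite (_ : dotp _ _ = E - t * F); last first.
  rewrite /E /F /dotp /sqn mulr_sumr -sumrB; apply: eq_bigr => l _.
  by rewrite !mxE; ring.
by rewrite /GRing.scale /=; ring.
Qed.

Lemma is_derive_qnorm_shifted Y h (t : R) : (2 <= n)%N ->
  is_derive t (1 : R) (fun u => qnorm (shifted Y h u))
    (2 * qnorm (shifted Y h t) *
     virial (qjoint (shifted Y h t)) (shifted Y h t) h).
Proof.
move=> n2; set Yt := shifted Y h t; have Z0 := lt0r_neq0 (qnorm_gt0 Yt n2).
have -> : 2 * qnorm Yt * virial (qjoint Yt) Yt h =
  \sum_(i < n) \sum_(j < n | j != i) - (1 + sqn (Yt i) (Yt j)) ^- 2 *:
    (- 2 * dotp (Yt i - Yt j) (h i - h j)).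
  rewrite /virial mulr_sumr; apply: eq_bigr => i _.
  rewrite (bigD1 i) //= {1}/qjoint eqxx mul0r add0r mulr_sumr.
  apply: eq_bigr => j ji; rewrite qjointE 1?eq_sym// /GRing.scale /=.
  by field; rewrite Z0 lt0r_neq0 ?one_sqn_gt0.
do 2!apply: is_derive_sumr => ?.
apply: is_deriveV; first by rewrite lt0r_neq0 ?one_sqn_gt0.
exact: is_derive_sqn_shifted.
Qed.

Lemma is_derive_tsne_loss_shifted X sig Y h (t : R) : (2 <= n)%N ->
  is_derive t (1 : R) (fun u => tsne_loss X sig (shifted Y h u))
    (2 * (virial (qjoint (shifted Y h t)) (shifted Y h t) h -
          virial (pjoint X sig) (shifted Y h t) h)).
Proof.
move=> n2; set Yt := shifted Y h t; have Z0 := qnorm_gt0 Yt n2.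
under eq_fun do rewrite tsne_lossE//.
rewrite (_ : 2 * _ = 0 + \sum_(i < n) \sum_(j < n) pjoint X sig i j *:
    (- 2 * dotp (Yt i - Yt j) (h i - h j) / (1 + sqn (Yt i) (Yt j)))
  + 2 * qnorm Yt * virial (qjoint Yt) Yt h / qnorm Yt); last first.
  rewrite mulrBr addrC add0r; congr (_ + _); last first.
    by field; exact: lt0r_neq0.
  rewrite /virial -mulNr !mulr_sumr; apply: eq_bigr => i _.
  by rewrite mulr_sumr; apply: eq_bigr => j _; rewrite /GRing.scale /=; ring.
have dattr : is_derive t (1 : R) (fun u => \sum_(i < n) \sum_(j < n)
    pjoint X sig i j * ln (1 + sqn (shifted Y h u i) (shifted Y h u j)))
  (\sum_(i < n) \sum_(j < n) pjoint X sig i j *: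
    (- 2 * dotp (Yt i - Yt j) (h i - h j) / (1 + sqn (Yt i) (Yt j)))).
  do 2!apply: is_derive_sumr => ?; apply: is_deriveZ.
  apply: is_derive_ln_comp; first exact: one_sqn_gt0.
  exact: is_derive_sqn_shifted.
have dnorm := is_derive_ln_comp Z0 (is_derive_qnorm_shifted Y h t n2).
exact: (is_deriveD (is_deriveD (is_derive_cst _ t 1) dattr) dnorm).
Qed.

Lemma tsne_minimizer_stationary X sig Y h : (2 <= n)%N ->
  is_tsne_minimizer X sig Y ->
  virial (pjoint X sig) Y h = virial (qjoint Y) Y h.
Proof.
move=> n2 minY; have shifted0 : shifted Y h 0 = Y.
  by apply/funext => i; rewrite /shifted scale0r subr0.
have dloss := is_derive_tsne_loss_shifted X sig Y h ^~ n2.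
have := @derive1_at_min _ (fun u => tsne_loss X sig (shifted Y h u)) (-1) 1 0.
case=> [|t _||t _|].
- by lra.
- by have [] := dloss t.
- by rewrite in_itv /= ltrN10 ltr01.
- by rewrite shifted0; exact: minY.
move=> _; have [_ ->] := dloss 0; rewrite shifted0 => /eqP.
by rewrite mulf_eq0 pnatr_eq0 /= subr_eq0 => /eqP.
Qed.

End Stationarity.

Section AnchorConstants.
Context {R : realType}.
Variables c theta B : R.
Hypotheses (c_gt0 : 0 < c) (theta_gt0 : 0 < theta) (B_ge1 : 1 <= B).

Definition qnorm_const : R := theta ^+ 2 / (2 * (1 + 4 * B)).

Definition anchor_const : R := 4 / (c * theta * qnorm_const).

Lemma qnorm_const_gt0 : 0 < qnorm_const.
Proof. by rewrite divr_gt0 ?exprn_gt0// mulr_gt0//; move: B_ge1; lra. Qed.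

Lemma anchor_const_gt0 : 0 < anchor_const.
Proof. by rewrite divr_gt0// mulr_gt0 ?qnorm_const_gt0// mulr_gt0. Qed.

End AnchorConstants.

Section RadialDisplacements.
Context {R : realType} {s n : nat}.
Variables (p : 'I_n -> 'I_n -> R) (Y : 'I_n -> 'rV[R]_s).

Definition stationary : Prop :=
  forall h, virial p Y h = virial (qjoint Y) Y h.

Record anchored (c theta B : R) (J : {set 'I_n}) : Prop := Anchored {
  anchored_many : theta * n%:R <= #|J|%:R;
  anchored_bounded : forall j, j \in J -> sqn (Y j) 0 <= B;
  anchored_attracting :
    forall i j, j \in J -> j != i -> c / n%:R ^+ 2 <= p i j }.

Definition tail (T : R) : R := #|[set i | T <= sqn (Y i) 0]%SET|%:R / n%:R.

Lemma tail_ge0 T : 0 <= tail T.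
Proof. by rewrite divr_ge0. Qed.

Lemma tail_le1 T : tail T <= 1.
Proof.
rewrite /tail; have [->|n0] := eqVneq (n%:R : R) 0.
  by rewrite invr0 mulr0.
have n_gt0 : 0 < n%:R :> R by rewrite lt0r n0 ler0n.
by rewrite ler_pdivrMr// mul1r ler_nat -[leqRHS]card_ord max_card.
Qed.

Lemma le_tail (T T' : R) : T <= T' -> tail T' <= tail T.
Proof.
move=> TT'; rewrite ler_wpM2r ?invr_ge0// ler_nat subset_leq_card//.
by apply/fintype.subsetP => i; rewrite !inE; exact: le_trans.
Qed.

Lemma sum_tail (T : R) : \sum_(i < n) (T <= sqn (Y i) 0)%R%:R = n%:R * tail T.
Proof.
have [n0|n_neq0] := eqVneq (n%:R : R) 0.
  rewrite n0 mul0r big1// => i _; exfalso.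
  by have := leq_ltn_trans (leq0n i) (ltn_ord i); rewrite -(ltr0n R) n0 ltxx.
rewrite mulrC divfK// -natr_sum -sum1_card.
by rewrite [in RHS]big_mkcond; congr (_%:R); apply: eq_bigr => i _; rewrite inE.
Qed.

Let N i := sqn (Y i) 0.
Let D i j := sqn (Y i) (Y j).

Definition radial (phi : R -> R) (i : 'I_n) : 'rV[R]_s := phi (N i) *: Y i.

Definition stretch (phi : R -> R) (i j : 'I_n) : R :=
  ((phi (N i) - phi (N j)) * (N i - N j) + (phi (N i) + phi (N j)) * D i j) / 2.

Lemma dotp_radial phi i j :
  dotp (Y i - Y j) (radial phi i - radial phi j) = stretch phi i j.
Proof. exact: dotp_scale_diff. Qed.

Lemma stretchC phi i j : stretch phi i j = stretch phi j i.
Proof. by rewrite /stretch /D sqnC; ring. Qed.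

Let D_ge0 i j : 0 <= D i j. Proof. exact: sqn_ge0. Qed.
Let N_le i j : N i <= 2 * D i j + 2 * N j. Proof. exact: sqn_le2. Qed.

Variables (c theta B : R) (J : {set 'I_n}).
Hypotheses (c_gt0 : 0 < c) (theta_gt0 : 0 < theta) (B_ge1 : 1 <= B).
Hypothesis n_large : 2 <= theta * n%:R.
Hypothesis p_ge0 : forall i j, 0 <= p i j.
Hypothesis anchoredJ : anchored c theta B J.

Let n_gt0 : 0 < n%:R :> R.
Proof. by rewrite -(pmulr_rgt0 _ theta_gt0); exact: lt_le_trans n_large. Qed.

Let kappa := qnorm_const theta B.

Let kappa_gt0 : 0 < kappa. Proof. exact: qnorm_const_gt0. Qed.

Lemma qnorm_ge : kappa * n%:R ^+ 2 <= qnorm Y.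
Proof.
have [manyJ boundedJ _] := anchoredJ; pose u := (1 + 4 * B)^-1.
have u_ge0 : 0 <= u by rewrite invr_ge0; move: B_ge1; lra.
have near k l : k \in J -> l \in J -> u <= (1 + D k l)^-1.
  move=> kJ lJ; rewrite lef_pV2 ?posrE ?one_sqn_gt0//; last by move: B_ge1; lra.
  have := sqn_le2 (Y k) 0 (Y l); rewrite [sqn 0 _]sqnC -/(D k l).
  by have := boundedJ _ kJ; have := boundedJ _ lJ; lra.
have row k : k \in J ->
    u * (#|J|%:R - 1) <= \sum_(l < n | l != k) (1 + D k l)^-1.
  move=> kJ; apply: (@le_trans _ _ (\sum_(l in J :\ k) u)).
    rewrite sumr_const -[leRHS]mulr_natr (cardsD1 k J) kJ natrD.
    by rewrite addrAC subrr add0r.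
  rewrite [leLHS]big_mkcond [leRHS]big_mkcond /=; apply: ler_sum => l _.
  rewrite !inE; case: (l != k) => //=; case: ifP => lJ; first exact: near.
  by rewrite invr_ge0 ltW// one_sqn_gt0.
apply: (@le_trans _ _ (\sum_(k in J) u * (#|J|%:R - 1))).
  rewrite sumr_const -[leRHS]mulr_natl.
  have -> : kappa * n%:R ^+ 2 = theta * n%:R * (u * (theta * n%:R / 2)).
    by rewrite /kappa /qnorm_const /u; field; move: B_ge1; lra.
  have tn_ge0 : 0 <= theta * n%:R := le_trans (ler0n _ 2) n_large.
  apply: ler_pM => //; first by rewrite mulr_ge0// divr_ge0.
  by rewrite ler_wpM2l//; move: manyJ n_large; lra.
rewrite /qnorm [leRHS](bigID [in J]) /= ler_wpDr//; last exact: ler_sum.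
by do 2!apply: sumr_ge0 => ? _; rewrite invr_ge0 ltW// one_sqn_gt0.
Qed.

Variable phi : R -> R.
Hypothesis phi_homo : {homo phi : x y / x <= y}.
Hypothesis phi_ge0 : forall x, 0 <= phi x.
Hypothesis phi_le1 : forall x, phi x <= 1.

Lemma stretch_ge0 i j : 0 <= stretch phi i j.
Proof.
wlog ji : i j / N j <= N i.
  move=> W; case: (leP (N j) (N i)) => [|/ltW] ji; first exact: W.
  by rewrite stretchC; exact: W.
by rewrite divr_ge0// addr_ge0// mulr_ge0 ?subr_ge0 ?phi_homo// addr_ge0.
Qed.

Variable T : R.
Hypothesis T_ge : B + 1 <= T.
Hypothesis phi0 : forall x, x < T -> phi x = 0.

Let T_gt0 : 0 < T. Proof. by move: B_ge1 T_ge; lra. Qed.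

Lemma attraction_ge :
  c * theta / 2 * (\sum_(i < n) phi (N i)) / n%:R <= virial p Y (radial phi).
Proof.
have [manyJ boundedJ attrJ] := anchoredJ.
have pair_ge i j : j \in J ->
    c / n%:R ^+ 2 * (phi (N i) / 2) <= p i j * (stretch phi i j / (1 + D i j)).
  move=> jJ; have Nj := boundedJ j jJ; rewrite -/(N j) in Nj.
  have S_ge0 : 0 <= stretch phi i j / (1 + D i j).
    by rewrite divr_ge0 ?stretch_ge0// ltW// one_sqn_gt0.
  have [NiT|TNi] := ltP (N i) T.
    by rewrite phi0// mul0r mulr0 mulr_ge0.
  apply: ler_pM => //.
  - by rewrite divr_ge0 ?exprn_ge0// ltW.
  - by rewrite divr_ge0.
  - by apply: attrJ => //; apply: contra_leN TNi => /eqP <-; move: Nj T_ge; lra.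
  have Nj_T : N j < T by move: Nj T_ge; lra.
  rewrite ler_pdivlMr ?one_sqn_gt0// /stretch (phi0 Nj_T).
  rewrite subr0 addr0 -mulrDr mulrAC ler_wpM2r// ler_wpM2l//.
  by move: Nj TNi T_ge; lra.
apply: (@le_trans _ _
    (\sum_(i < n) #|J|%:R * (c / n%:R ^+ 2 * (phi (N i) / 2)))).
  rewrite -mulr_sumr -mulr_sumr -mulr_suml.
  set S := \sum_(i < n) _; have S_ge0 : 0 <= S by apply: sumr_ge0.
  have -> : c * theta / 2 * S / n%:R = theta * n%:R * (c / n%:R ^+ 2 * (S / 2)).
    by field; exact: lt0r_neq0.
  by rewrite ler_wpM2r// !mulr_ge0 ?invr_ge0 ?exprn_ge0// ltW.
apply: ler_sum => i _; under [leRHS]eq_bigr do rewrite dotp_radial.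
rewrite mulr_natl -sumr_const big_mkcond; apply: ler_sum => j _.
case: ifP => [jJ|_]; first exact: pair_ge.
by rewrite mulr_ge0// divr_ge0 ?stretch_ge0// ltW// one_sqn_gt0.
Qed.

Variable slack : R.
Hypothesis slack_le : 0 <= slack <= T.
Hypothesis phi_increment : forall i j, N j <= N i ->
  (phi (N i) - phi (N j)) * (N i - N j) <= 2 * slack + 4 * D i j.

Let repulsion i j : R :=
  (T <= N i)%R%:R * ((slack + 3) * (T / 4 <= N j)%R%:R + 28 / T).

Let repulsion_ge0 i j : 0 <= repulsion i j.
Proof.
have [/andP[slack_ge0 _] Tge0] := (slack_le, ltW T_gt0).
by rewrite mulr_ge0// addr_ge0 ?divr_ge0 ?mulr_ge0 ?addr_ge0.
Qed.

Lemma stretch_le i j :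
  N j <= N i -> stretch phi i j / (1 + D i j) ^+ 2 <= repulsion i j.
Proof.
move=> ji; have [/andP[slack_ge0 slack_leT] D0] := (slack_le, D_ge0 i j).
have [NiT|TNi] := ltP (N i) T.
  rewrite /stretch !phi0 ?(le_lt_trans ji)// subrr addr0 !mul0r addr0 !mul0r.
  exact: repulsion_ge0.
rewrite /repulsion TNi mul1r ler_pdivrMr ?exprn_gt0 ?one_sqn_gt0//.
have stretch_D : stretch phi i j <= slack + 3 * D i j.
  have := phi_increment ji; have := ler_wpM2r D0 (phi_le1 (N i)).
  by have := ler_wpM2r D0 (phi_le1 (N j)); rewrite /stretch; lra.
apply: (le_trans stretch_D).
have T_far : 0 <= 28 / T by rewrite divr_ge0// ltW.
have [close|far] := leP (T / 4) (N j).
  rewrite mulr1 mulrDl; have := mulr_ge0 T_far (sqr_ge0 (1 + D i j)).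
  have := mulr_ge0 slack_ge0 D0; have := mulr_ge0 slack_ge0 (sqr_ge0 (D i j)).
  by have := sqr_ge0 (D i j); lra.
have DT : T / 4 <= D i j by have := N_le i j; lra.
have D_le : 7 * D i j <= 28 / T * D i j ^+ 2.
  rewrite [leRHS](_ : _ = 7 * D i j * (D i j / (T / 4))); last first.
    by field; exact: lt0r_neq0.
  by rewrite ler_peMr ?mulr_ge0// ler_pdivlMr ?mul1r// divr_gt0.
by rewrite mulr0 add0r; have := mulr_ge0 T_far D0; lra.
Qed.

Lemma repulsion_le : virial (qjoint Y) Y (radial phi) <=
  2 / kappa * (tail T * ((slack + 3) * tail (T / 4) + 28 / T)).
Proof.
have Z_gt0 : 0 < qnorm Y.
  by apply: lt_le_trans qnorm_ge; rewrite mulr_gt0 ?exprn_gt0.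
set tails := tail T * _; have tails_ge0 : 0 <= tails.
  have [/andP[slack_ge0 _] Tge0] := (slack_le, ltW T_gt0).
  rewrite mulr_ge0 ?tail_ge0// addr_ge0 ?divr_ge0 ?mulr_ge0 ?tail_ge0//.
  by rewrite addr_ge0.
have pair_le i j : qjoint Y i j * (stretch phi i j / (1 + D i j)) <=
    (repulsion i j + repulsion j i) / qnorm Y.
  have [->|ij] := eqVneq i j.
    by rewrite /qjoint eqxx mul0r divr_ge0 ?addr_ge0 ?repulsion_ge0// ltW.
  rewrite qjointE// -/(D i j) ler_pdivlMr// (_ : _ * _ * _ =
    stretch phi i j / (1 + D i j) ^+ 2); last first.
    by field; rewrite !lt0r_neq0 ?one_sqn_gt0.
  have [ji|/ltW ij'] := leP (N j) (N i); first by rewrite ler_wpDr ?stretch_le.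
  by rewrite ler_wpDl// stretchC /D sqnC stretch_le.
have sum_repulsion :
    \sum_(i < n) \sum_(j < n) repulsion i j = n%:R ^+ 2 * tails.
  under eq_bigr do rewrite -mulr_sumr big_split /= -mulr_sumr sum_tail
    sumr_const card_ord -[X in _ * (_ + X)]mulr_natl.
  by rewrite -mulr_suml sum_tail /tails; ring.
apply: (@le_trans _ _ (2 * n%:R ^+ 2 * tails / qnorm Y)).
  rewrite [leRHS](_ : _ = \sum_(i < n) \sum_(j < n)
      (repulsion i j + repulsion j i) / qnorm Y); last first.
    under eq_bigr do rewrite -mulr_suml big_split /=.
    rewrite -mulr_suml big_split /= [X in _ + X]exchange_big /= sum_repulsion.
    by ring.
  by do 2!apply: ler_sum => ? _; rewrite dotp_radial.
rewrite ler_pdivrMr//.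
have -> : 2 * n%:R ^+ 2 * tails = 2 / kappa * tails * (kappa * n%:R ^+ 2).
  by field; exact: lt0r_neq0.
by rewrite ler_wpM2l ?qnorm_ge// mulr_ge0// divr_ge0// ltW.
Qed.

Lemma radial_mean_le : stationary ->
  (\sum_(i < n) phi (N i)) / n%:R <=
  anchor_const c theta B * (tail T * ((slack + 3) * tail (T / 4) + 28 / T)).
Proof.
move=> statY; have ct_gt0 : 0 < c * theta / 2 by rewrite divr_gt0 ?mulr_gt0.
rewrite -(ler_pM2l ct_gt0) [leLHS]mulrA (le_trans attraction_ge)// statY.
rewrite (le_trans repulsion_le)// le_eqVlt; apply/orP; left; apply/eqP.
by rewrite /anchor_const -/kappa; field; rewrite !lt0r_neq0.
Qed.

End RadialDisplacements.

Section Cutoff.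
Context {R : realType}.
Implicit Types T x y : R.

Definition cutoff T x : R := if T <= x then 1 - T / x else 0.

Lemma cutoff_ge0 T x : 0 < T -> 0 <= cutoff T x.
Proof.
move=> T0; rewrite /cutoff; case: ifP => // Tx; rewrite subr_ge0.
by rewrite ler_pdivrMr ?mul1r// (lt_le_trans T0).
Qed.

Lemma cutoff_le1 T x : 0 < T -> cutoff T x <= 1.
Proof.
move=> T0; rewrite /cutoff; case: ifP => // Tx.
by rewrite lerBlDr lerDl divr_ge0 ?ltW// (lt_le_trans T0).
Qed.

Lemma cutoff_homo T : 0 < T -> {homo cutoff T : x y / x <= y}.
Proof.
move=> T0 x y xy; rewrite {1}/cutoff.
case: ifPn => [Tx|_]; last exact: cutoff_ge0.
rewrite /cutoff (le_trans Tx xy) lerD2l lerN2 ler_pM2l// lef_pV2 ?posrE//.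
  by rewrite (lt_le_trans T0)// (le_trans Tx).
exact: lt_le_trans Tx.
Qed.

Lemma cutoff_sub_le T x y : 0 < T -> 0 <= y <= x ->
  cutoff T x - cutoff T y <= (x - y) / x.
Proof.
move=> T0 /andP[y0 yx]; rewrite /cutoff.
have [Tx|xT] := leP T x; last first.
  rewrite (lt_geF (le_lt_trans yx xT)) subrr.
  by rewrite divr_ge0 ?subr_ge0// (le_trans y0).
have x0 := lt_le_trans T0 Tx; have [Ty|/ltW yT] := leP T y; last first.
  by rewrite subr0 mulrBl divff ?lt0r_neq0// lerD2l lerN2 ler_pM2r ?invr_gt0.
have y_gt0 := lt_le_trans T0 Ty.
have -> : 1 - T / x - (1 - T / y) = T / y * ((x - y) / x).
  by field; rewrite !lt0r_neq0.
by rewrite ler_piMl ?divr_ge0 ?subr_ge0 ?(ltW x0)// ler_pdivrMr ?mul1r.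
Qed.

End Cutoff.

Lemma dilation_nonincreasing_le {R : realType} (f : R -> R) (q b C : R) :
  1 < q -> 0 < b ->
  (forall x, b <= x <= q * b -> f x <= C) ->
  (forall x, b <= x -> f (q * x) <= f x) ->
  forall x, b <= x -> f x <= C.
Proof.
move=> q1 b0 base dilate x bx; have q0 : 0 < q := lt_trans ltr01 q1.
have bounded k y : b <= y <= q ^+ k * b -> f y <= C.
  elim: k y => [|k IH] y /andP[by_ yk].
    by apply: base; rewrite by_ (le_trans yk)// expr0 ler_pM2r// ltW.
  have [yq|/ltW qy] := leP y (q * b); first by apply: base; rewrite by_.
  have bq : b <= y / q by rewrite ler_pdivlMr// mulrC.
  rewrite -[y](divfK (lt0r_neq0 q0)) mulrC (le_trans (dilate _ bq))// IH// bq.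
  by rewrite ler_pdivrMr// mulrAC -exprSr.
have qinv1 : `|q^-1| < 1 by rewrite gtr0_norm ?invr_gt0// invf_lt1.
have x0 : 0 < x := lt_le_trans b0 bx.
have /filter_ex[k /ltW] : \forall k \near \oo, q^-1 ^+ k < b / x.
  by apply: (cvgr_lt 0 (cvg_expr qinv1)); exact: divr_gt0.
rewrite exprVn ler_pdivlMr// => qk.
by apply: (bounded k); rewrite bx -ler_pdivrMl ?exprn_gt0.
Qed.

Lemma quadratic_decay {R : realType} (t : R -> R) (K b : R) :
  0 < b -> 0 <= K -> (forall x, 0 <= t x <= 1) ->
  {homo t : x y / x <= y >-> y <= x} ->
  (forall x, b <= x -> t (4 * x) <= K * t x * (t (x / 4) + x^-1)) ->
  16 * K * (t (b / 4) + b^-1) <= 1 ->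
  forall x, b <= x -> t x * x ^+ 2 <= 16 * b ^+ 2.
Proof.
move=> b0 K0 t01 t_homo rec small.
apply: (@dilation_nonincreasing_le _ (fun x => t x * x ^+ 2) 4 b) => //
  [|x|x bx].
- by rewrite ltr1n.
- move=> /andP[bx x4b]; have /andP[t0 t1] := t01 x; rewrite -[leRHS]mul1r.
  rewrite ler_pM ?sqr_ge0// (_ : 16 * b ^+ 2 = (4 * b) ^+ 2); last by ring.
  by rewrite lerXn2r// nnegrE; lra.
have x0 : 0 < x := lt_le_trans b0 bx; have /andP[t0 _] := t01 x.
have factor : 16 * K * (t (x / 4) + x^-1) <= 1.
  apply: le_trans small; rewrite ler_wpM2l ?mulr_ge0// lerD ?lef_pV2//.
  by apply: t_homo; rewrite ler_pM2r.
have tx2_ge0 : 0 <= t x * x ^+ 2 by rewrite mulr_ge0// sqr_ge0.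
have := ler_wpM2r (sqr_ge0 (4 * x)) (rec x bx).
have := ler_wpM2l tx2_ge0 factor; lra.
Qed.

Lemma outermost_radius_le {R : realType} (K b M t : R) :
  0 <= K -> 1 <= M -> 0 <= t -> t * (M / 4) ^+ 2 <= 16 * b ^+ 2 ->
  1 <= K * ((M + 3) * t + 28 / M) -> M <= K * (64 * (16 * b ^+ 2) + 28).
Proof.
move=> K0 M1 t0 decay force; have M0 : 0 < M by lra.
have M_le : M <= K * ((M + 3) * M * t + 28).
  rewrite -(ler_pM2r M0) mul1r in force; apply: (le_trans force).
  rewrite le_eqVlt; apply/orP; left; apply/eqP.
  by field; exact: lt0r_neq0.
apply: (le_trans M_le); rewrite ler_wpM2l// lerD2r.
have : 0 <= (3 * M ^+ 2 - 3 * M) * t.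
  by rewrite mulr_ge0// subr_ge0 ler_pM2l// ler_eXnr.
by lra.
Qed.

Section TailRecursion.
Context {R : realType} {s n : nat}.
Variables (p : 'I_n -> 'I_n -> R) (Y : 'I_n -> 'rV[R]_s).
Variables (c theta B : R) (J : {set 'I_n}).
Hypotheses (c_gt0 : 0 < c) (theta_gt0 : 0 < theta) (B_ge1 : 1 <= B).
Hypothesis n_large : 2 <= theta * n%:R.
Hypothesis p_ge0 : forall i j, 0 <= p i j.
Hypothesis anchoredJ : anchored p Y c theta B J.
Hypothesis statY : stationary p Y.

Let n_gt0 : 0 < n%:R :> R.
Proof. by rewrite -(pmulr_rgt0 _ theta_gt0); exact: lt_le_trans n_large. Qed.

Let N i := sqn (Y i) 0.
Let K := anchor_const c theta B.

Let K_gt0 : 0 < K. Proof. exact: anchor_const_gt0. Qed.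

Let mean_le := radial_mean_le c_gt0 theta_gt0 B_ge1 n_large p_ge0 anchoredJ.

Lemma tail_recursion (T : R) : B + 1 <= T ->
  tail Y (4 * T) <= 40 * K * tail Y T * (tail Y (T / 4) + T^-1).
Proof.
move=> BT; have T0 : 0 < T by move: B_ge1 BT; lra.
have increment i j : N j <= N i ->
    (cutoff T (N i) - cutoff T (N j)) * (N i - N j) <=
    2 * 0 + 4 * sqn (Y i) (Y j).
  move=> ji; rewrite mulr0 add0r; have Nj0 : 0 <= N j := sqn_ge0 _ _.
  have NjNi : 0 <= N j <= N i by rewrite Nj0.
  have diff_ge0 : 0 <= N i - N j by rewrite subr_ge0.
  apply: (le_trans (ler_wpM2r diff_ge0 (cutoff_sub_le T0 NjNi))).
  have [Ni0|/lt0r_neq0] := leP (N i) 0.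
    have -> : N i - N j = 0.
      by apply/eqP; rewrite eq_le diff_ge0 andbT subr_le0 (le_trans Ni0).
    by rewrite mulr0 mulr_ge0 ?sqn_ge0.
  have Ni_ge0 := le_trans Nj0 ji; rewrite mulrAC -expr2 => Ni_neq0.
  rewrite ler_pdivrMr ?lt0r ?Ni_neq0// (le_trans (sqn_sub_sqr_le _ _))//.
  by have := ler_wpM2r (sqn_ge0 (Y i) (Y j)) ji; rewrite -/(N i) -/(N j); lra.
have slack_le : 0 <= (0 : R) <= T by rewrite lexx ltW.
have below x : x < T -> cutoff T x = 0 by rewrite /cutoff => /lt_geF ->.
have := mean_le (cutoff_homo T0) (fun x => cutoff_ge0 x T0)
  (fun x => cutoff_le1 x T0) BT below slack_le increment statY.
set m := _ / n%:R; rewrite add0r => mean_cutoff.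
have markov : 3 / 4 * tail Y (4 * T) <= m.
  rewrite ler_pdivlMr// mulrAC -mulrA -sum_tail mulr_sumr.
  apply: ler_sum => i _; rewrite -/(N i).
  have [Ti|_] := leP (4 * T) (N i); last by rewrite mulr0 cutoff_ge0.
  rewrite mulr1 /cutoff ifT; last by lra.
  suff : T / N i <= 1 / 4 by lra.
  by rewrite ler_pdivrMr; lra.
have [tailT_ge0 tail4_ge0] := (tail_ge0 Y T, tail_ge0 Y (T / 4)).
have Tinv_ge0 : 0 <= T^-1 by rewrite invr_ge0 ltW.
have := mulr_ge0 (mulr_ge0 (ltW K_gt0) tailT_ge0) tail4_ge0.
have := mulr_ge0 (mulr_ge0 (ltW K_gt0) tailT_ge0) Tinv_ge0.
rewrite -/K in mean_cutoff; lra.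
Qed.

Lemma outermost_bound (i0 : 'I_n) : (forall j, N j <= N i0) -> B + 1 <= N i0 ->
  1 <= K * ((N i0 + 3) * tail Y (N i0 / 4) + 28 / N i0).
Proof.
set M := N i0 => i0max BM; have M0 : 0 < M by move: B_ge1 BM; lra.
pose step x : R := (M <= x)%R%:R.
have step_homo : {homo step : x y / x <= y}.
  by move=> x y xy; rewrite ler_nat; case: leP => // /le_trans/(_ xy) ->.
have step_ge0 x : 0 <= step x by [].
have step_le1 x : step x <= 1 by rewrite lern1; case: (M <= x).
have below x : x < M -> step x = 0 by rewrite /step => /lt_geF ->.
have slack_le : 0 <= M <= M by rewrite lexx ltW.
have increment i j : N j <= N i ->
    (step (N i) - step (N j)) * (N i - N j) <= 2 * M + 4 * sqn (Y i) (Y j).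
  move=> ji; have := i0max i; have : 0 <= N j := sqn_ge0 _ _.
  have := sqn_ge0 (Y i) (Y j); have := step_ge0 (N j); have := step_le1 (N i).
  move=> step1 step0 D0 Nj0 Ni.
  have step_diff : step (N i) - step (N j) <= 1 by lra.
  have NN0 : 0 <= N i - N j by rewrite subr_ge0.
  by have := ler_wpM2r NN0 step_diff; lra.
have := mean_le step_homo step_ge0 step_le1 BM below slack_le increment statY.
rewrite sum_tail mulrAC divff ?mul1r ?lt0r_neq0// mulrCA.
have tail_gt0 : 0 < tail Y M.
  rewrite divr_gt0// ltr0n card_gt0; apply/set0Pn; exists i0.
  by rewrite inE.
by rewrite -[leLHS]mulr1 ler_pM2l.
Qed.

Section InitialScale.
Variable b : R.
Hypotheses (b_ge : B + 1 <= b).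
Hypothesis b_small : 16 * (40 * K) * (tail Y (b / 4) + b^-1) <= 1.

Let b_gt0 : 0 < b. Proof. by move: B_ge1 b_ge; lra. Qed.

Lemma tail_quadratic_decay T : b <= T -> tail Y T * T ^+ 2 <= 16 * b ^+ 2.
Proof.
move=> bT; apply: (quadratic_decay b_gt0 _ _ _ _ b_small bT) => //.
- by rewrite mulr_ge0// ltW.
- by move=> x; rewrite tail_ge0 tail_le1.
- exact: le_tail.
- by move=> x bx; apply: tail_recursion; exact: le_trans bx.
Qed.

Lemma embedding_le i : N i <= 4 * b + K * (64 * (16 * b ^+ 2) + 28).
Proof.
have [im _ im_max] := @arg_maxP _ _ 'I_n i xpredT N isT.
apply: (le_trans (im_max i isT)); set M := N im.
have bound_ge0 : 0 <= K * (64 * (16 * b ^+ 2) + 28).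
  rewrite mulr_ge0 ?(ltW K_gt0)// addr_ge0// mulr_ge0//.
  by rewrite mulr_ge0 ?sqr_ge0.
have [Mb|/ltW bM] := leP M (4 * b); first by lra.
rewrite ler_wpDl//; first by rewrite mulr_ge0// ltW.
apply: (outermost_radius_le (t := tail Y (M / 4))).
- exact: ltW.
- by move: b_ge B_ge1; lra.
- exact: tail_ge0.
- by apply: tail_quadratic_decay; lra.
- apply: outermost_bound => [j|]; first exact: im_max.
  by rewrite -/M; move: b_ge B_ge1; lra.
Qed.

End InitialScale.

End TailRecursion.

Lemma anchored_embedding_bounded {R : realType} (c theta B : R) :
  0 < c -> 0 < theta -> 1 <= B ->
  exists2 eps : R, 0 < eps & forall T : R, exists radius : R,
    forall (s n : nat) (p : 'I_n -> 'I_n -> R) (Y : 'I_n -> 'rV[R]_s)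
      (J : {set 'I_n}),
    2 <= theta * n%:R -> (forall i j, 0 <= p i j) ->
    anchored p Y c theta B J -> stationary p Y -> tail Y T <= eps ->
    forall i, sqn (Y i) 0 <= radius.
Proof.
move=> c0 theta0 B1; pose K := anchor_const c theta B.
have K0 : 0 < K := anchor_const_gt0 c0 theta0 B1.
pose eps := (32 * (40 * K))^-1.
have eps0 : 0 < eps by rewrite /eps invr_gt0 mulr_gt0// mulr_gt0.
exists eps => // T; pose b := Num.max (B + 1) (Num.max (4 * T) eps^-1).
have Bb : B + 1 <= b by rewrite le_max lexx.
have Tb : 4 * T <= b by rewrite !le_max lexx orbT.
have epsb : eps^-1 <= b by rewrite !le_max lexx !orbT.
have b0 : 0 < b by lra.
exists (4 * b + K * (64 * (16 * b ^+ 2) + 28)).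
move=> s n p Y J n_large p0 anchoredJ statY small.
have t_eps : tail Y (b / 4) <= eps.
  by rewrite (le_trans _ small)// le_tail//; lra.
have b_eps : b^-1 <= eps by rewrite -[leRHS]invrK lef_pV2// posrE invr_gt0.
have Keps : K * eps * 40 = 32^-1 by rewrite /eps; field; exact: lt0r_neq0.
apply: (embedding_le c0 theta0 B1 n_large p0 anchoredJ statY Bb).
have := ler_wpM2l (ltW K0) (lerD t_eps b_eps).
by move: Keps; rewrite -/K; lra.
Qed.

Lemma mul_ln_sub_le {R : realType} (a b : R) :
  0 <= a -> 0 < b -> a * ln b - a * ln a <= b - a.
Proof.
rewrite le_eqVlt => /predU1P[<-|a0] b0; first by rewrite !mul0r !subr0 ltW.
rewrite -mulrBr -ln_div ?posrE// mulrC -ler_pdivlMr//.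
have -> : b / a = 1 + (b - a) / a by field; exact: lt0r_neq0.
apply: le_ln1Dx; rewrite -subr_gt0.
have -> : (b - a) / a - -1 = b / a by field; exact: lt0r_neq0.
exact: divr_gt0.
Qed.

Section Entropy.
Context {R : realType} {I : finType}.
Implicit Types p q : I -> R.

Definition entropy p : R := - \sum_i p i * ln (p i).

Lemma gibbs_inequality p q : (forall i, 0 <= p i) -> (forall i, 0 < q i) ->
  \sum_i q i <= \sum_i p i -> entropy p <= - \sum_i p i * ln (q i).
Proof.
move=> p0 q0 qp; rewrite lerN2 -subr_le0 -sumrB.
apply: (@le_trans _ _ (\sum_i (q i - p i))); last by rewrite sumrB subr_le0.
by apply: ler_sum => i _; exact: mul_ln_sub_le.
Qed.

(* Gibbs' inequality against the weights m / 2|I| on A and 1 / 2|I| off A. *)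
Lemma mass_ln_le_entropy_defect p (A : {set I}) (m : R) :
  (forall i, 0 <= p i) -> \sum_i p i = 1 -> 0 < m -> m * #|A|%:R <= #|I|%:R ->
  (\sum_(i in A) p i) * ln m <= ln (2 * #|I|%:R) - entropy p.
Proof.
move=> p0 p1 m0 mA; pose q i : R := (if i \in A then m else 1) / (2 * #|I|%:R).
have I0 : 0 < #|I|%:R :> R.
  rewrite ltr0n lt0n; apply: contra_eq_neq p1 => I0.
  by rewrite big1 1?eq_sym ?oner_neq0// => i; have := fintype0 i I0.
have q0 i : 0 < q i by rewrite /q; case: ifP => _; rewrite divr_gt0 ?mulr_gt0.
have q1 : \sum_i q i <= \sum_i p i.
  rewrite p1 -mulr_suml ler_pdivrMr ?mulr_gt0// mul1r (bigID [in A]) /=.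
  rewrite (eq_bigr (fun=> m)) => [|i ->//]; rewrite sumr_const -mulr_natr.
  rewrite (eq_bigr (fun=> 1)) => [|i /negbTE ->//]; rewrite sumr_const.
  by have := max_card [predC A]; rewrite -(ler_nat R); lra.
have := gibbs_inequality p0 q0 q1.
suff -> : \sum_i p i * ln (q i) =
    (\sum_(i in A) p i) * ln m - ln (2 * #|I|%:R) by lra.
have -> : ln (2 * #|I|%:R) = \sum_i p i * ln (2 * #|I|%:R).
  by rewrite -mulr_suml p1 mul1r.
rewrite mulr_suml [in RHS]big_mkcond -sumrB.
apply: eq_bigr => i _; rewrite /q; case: ifP => _.
  by rewrite ln_div ?posrE ?mulr_gt0// mulrBr.
by rewrite ln_div ?posrE ?mulr_gt0// ln1 mulrBr mulr0.
Qed.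

End Entropy.

Section Bandwidth.
Context {R : realType} {d n : nat}.
Variables (X : 'I_n -> 'rV[R]_d) (sig : 'I_n -> R).

Definition precision (sg : R) : R := (2 * sg ^+ 2)^-1.

Lemma precision_ge0 sg : 0 <= precision sg.
Proof. by rewrite invr_ge0 mulr_ge0 ?sqr_ge0. Qed.

Lemma gk_ge sg (x y : 'rV[R]_d) g :
  sqn x y <= g -> expR (- (g * precision sg)) <= gk sg x y.
Proof.
by move=> xyg; rewrite ler_expR mulNr lerN2 ler_wpM2r ?precision_ge0.
Qed.

Lemma gk_le sg (x y : 'rV[R]_d) f :
  f <= sqn x y -> gk sg x y <= expR (- (f * precision sg)).
Proof.
by move=> fxy; rewrite ler_expR mulNr lerN2 ler_wpM2r ?precision_ge0.
Qed.

Lemma gk_le1 sg (x y : 'rV[R]_d) : gk sg x y <= 1.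
Proof. by rewrite (le_trans (gk_le _ (sqn_ge0 x y)))// mul0r oppr0 expR0. Qed.

Lemma pcond_ge (j i : 'I_n) (b g : R) : j != i ->
  precision (sig j) <= b -> sqn (X j) (X i) <= g ->
  expR (- (g * b)) / n%:R <= pcond X sig j i.
Proof.
move=> ji prec j_near; rewrite /pcond (negbTE ji).
have g0 : 0 <= g := le_trans (sqn_ge0 _ _) j_near.
apply: ler_pM; rewrite ?expR_ge0 ?invr_ge0//.
  by apply: le_trans (gk_ge _ j_near); rewrite ler_expR lerN2 ler_wpM2l.
have S0 : 0 < \sum_(k < n | k != j) gk (sig j) (X j) (X k).
  by apply: sumr_neq_gt0 => [|k]; [exact: ord_neq_gt1 ji|exact: expR_gt0].
have n0 : (0 < n)%N := leq_ltn_trans (leq0n i) (ltn_ord i).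
rewrite lef_pV2 ?posrE ?ltr0n//.
apply: (@le_trans _ _ (\sum_(k < n) 1)); last by rewrite sumr_const card_ord.
rewrite big_mkcond; apply: ler_sum => k _; case: ifP => // _; exact: gk_le1.
Qed.

Lemma pcond_far_mass_le (A C : {set 'I_n}) (j : 'I_n) (f g : R) :
  (0 < #|C|)%N -> j \notin C ->
  (forall k, k \in C -> sqn (X j) (X k) <= g) ->
  (forall k, k \notin A -> f <= sqn (X j) (X k)) ->
  \sum_(k < n | k \notin A) pcond X sig j k <=
  n%:R / #|C|%:R * expR (- ((f - g) * precision (sig j))).
Proof.
move=> C0 jC C_near A_far; set b := precision _.
have C_gt0 : 0 < #|C|%:R :> R by rewrite ltr0n.
set S := \sum_(k < n | k != j) gk (sig j) (X j) (X k).
have S_ge : #|C|%:R * expR (- (g * b)) <= S.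
  rewrite mulr_natl -sumr_const /S big_mkcond [leRHS]big_mkcond /=.
  apply: ler_sum => k _; case: ifPn => kC; last first.
    by case: ifP => // _; exact: expR_ge0.
  by rewrite ifT ?gk_ge ?C_near//; apply: contraNneq jC => <-.
have S0 : 0 < S by apply: lt_le_trans S_ge; rewrite mulr_gt0 ?expR_gt0.
apply: (@le_trans _ _ (n%:R * expR (- (f * b)) / S)).
  apply: (@le_trans _ _ (\sum_(k < n) expR (- (f * b)) / S)); last first.
    by rewrite sumr_const card_ord -[leLHS]mulr_natl mulrA.
  rewrite big_mkcond; apply: ler_sum => k _.
  have e0 : 0 <= expR (- (f * b)) / S by rewrite divr_ge0 ?expR_ge0// ltW.
  case: ifP => // kA; rewrite /pcond; case: eqP => // _.
  by rewrite ler_wpM2r ?invr_ge0 ?(ltW S0)// gk_le// A_far.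
have ratio_ge0 : 0 <= n%:R / #|C|%:R * expR (- ((f - g) * b)).
  by rewrite mulr_ge0 ?divr_ge0 ?expR_ge0.
rewrite ler_pdivrMr// (le_trans _ (ler_wpM2l ratio_ge0 S_ge))//.
rewrite mulrACA -expRD divfK ?lt0r_neq0// ler_wpM2l// ler_expR.
by lra.
Qed.

End Bandwidth.

Section Calibration.
Context {R : realType} {d n : nat}.
Variables (X : 'I_n -> 'rV[R]_d) (sig : 'I_n -> R) (rho : R) (m : nat).
Hypotheses (n_ge2 : (2 <= n)%N) (rho01 : 0 < rho < 1).
Hypothesis m_rho : 4 <= m%:R * rho ^+ 2.
Hypothesis calX : calibrated rho X sig.

Let n_gt0 : 0 < n%:R :> R. Proof. by rewrite ltr0n ltnW. Qed.

Lemma entropy_calibrated i : entropy (pcond X sig i) = ln (n%:R * rho).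
Proof.
have [_ <-] := calX i; congr (- _); rewrite (bigD1 i) //=.
by rewrite {1}/pcond eqxx mul0r add0r.
Qed.

Lemma calibrated_mass_le (A : {set 'I_n}) (j : 'I_n) : (m * #|A| <= n)%N ->
  \sum_(k in A) pcond X sig j k <= 2^-1.
Proof.
move=> mA; case/andP: rho01 => rho0 rho1; have rho2 := exprn_gt0 2 rho0.
have m0 : 0 < m%:R :> R by rewrite -(pmulr_lgt0 _ rho2) (lt_le_trans _ m_rho).
have := @mass_ln_le_entropy_defect _ _ (pcond X sig j) A m%:R
  (pcond_ge0 X sig j) (sum_pcond X sig j n_ge2) m0.
rewrite card_ord -natrM ler_nat => /(_ mA).
have -> : ln (2 * n%:R) - entropy (pcond X sig j) = ln (2 / rho).
  rewrite entropy_calibrated -ln_div ?posrE ?mulr_gt0//; congr ln.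
  by field; rewrite !lt0r_neq0.
have entropy_gap_gt0 : 0 < ln (2 / rho) by rewrite ln_gt0// ltr_pdivlMr//; lra.
have ln_m_ge : 2 * ln (2 / rho) <= ln m%:R.
  rewrite mulr_natl -lnXn ?divr_gt0// ler_ln ?posrE ?exprn_gt0 ?divr_gt0//.
  by rewrite expr_div_n ler_pdivrMr//; move: m_rho; lra.
set mass := \sum_(k in A) _ => mass_le.
have mass0 : 0 <= mass by apply: sumr_ge0 => k _; exact: pcond_ge0.
have := le_trans (ler_wpM2l mass0 ln_m_ge) mass_le.
by rewrite mulrA ger_pMl//; lra.
Qed.

Lemma calibrated_precision_le (A C : {set 'I_n}) (j : 'I_n) (theta f g : R) :
  (m * #|A| <= n)%N -> 0 < theta -> theta * n%:R <= #|C|%:R -> j \notin C ->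
  (forall k, k \in C -> sqn (X j) (X k) <= g) ->
  (forall k, k \notin A -> f <= sqn (X j) (X k)) ->
  g < f -> precision (sig j) <= ln (2 / theta) / (f - g).
Proof.
move=> mA theta0 thetaC jC C_near far_A gf.
have C_gt0 : 0 < #|C|%:R :> R by apply: lt_le_trans thetaC; rewrite mulr_gt0.
have := @pcond_far_mass_le _ _ _ X sig A C j f g.
rewrite -(ltr0n R) => /(_ C_gt0 jC C_near far_A).
set e := expR _ => far_le; have e0 : 0 < e := expR_gt0 _.
have mass_ge : 2^-1 <= \sum_(k < n | k \notin A) pcond X sig j k.
  have := calibrated_mass_le j mA; have := sum_pcond X sig j n_ge2.
  by rewrite (bigID [in A]) /=; lra.
have theta_e : theta <= 2 * e.
  have := le_trans mass_ge far_le; rewrite mulrAC ler_pdivlMr// => C_le.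
  rewrite -(ler_pM2r n_gt0); lra.
rewrite ler_pdivlMr ?subr_gt0// -ler_expR lnK ?posrE ?divr_gt0//.
rewrite ler_pdivlMr// -(ler_pM2r e0) mulrAC -expRD [_ * (f - g)]mulrC.
by rewrite subrr expR0 mul1r.
Qed.

Variables (s : nat) (Y : 'I_n -> 'rV[R]_s) (A J : {set 'I_n}).
Variables (x0 : 'rV[R]_d) (r theta B rX : R).
Hypothesis r_gt0 : 0 < r.
Hypothesis A_small : (m * #|A| <= n)%N.
Hypothesis A_far : forall k, k \notin A -> r <= sqn (X k) x0.
Hypothesis theta_gt0 : 0 < theta.
Hypothesis n_large : 2 <= theta * n%:R.
Hypothesis J_large : theta * n%:R <= #|J|%:R.
Hypothesis J_near : forall j, j \in J -> sqn (X j) x0 <= r / 20.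

Lemma near_precision_le j :
  j \in J -> precision (sig j) <= 4 * ln (4 / theta) / r.
Proof.
move=> jJ; have -> : 4 * ln (4 / theta) / r =
    ln (2 / (theta / 2)) / (9 / 20 * r - r / 5).
  have -> : 2 / (theta / 2) = 4 / theta by field; exact: lt0r_neq0.
  have -> : 9 / 20 * r - r / 5 = r / 4 by lra.
  by field; exact: lt0r_neq0.
apply: (calibrated_precision_le A_small (C := J :\ j)).
- by rewrite divr_gt0.
- by have := J_large; rewrite (cardsD1 j J) jJ natrD mulr1n; move: n_large; lra.
- by rewrite !inE eqxx.
- move=> k; rewrite in_setD1 => /andP[_ kJ]; have := sqn_le2 (X j) x0 (X k).
  by rewrite [sqn x0 _]sqnC; have := J_near jJ; have := J_near kJ; lra.
- move=> k /A_far rk; have := sqn_le2 (X k) (X j) x0.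
  by rewrite [sqn (X k) (X j)]sqnC; have := J_near jJ; lra.
- by move: r_gt0; lra.
Qed.

Hypothesis X_bounded : forall i, sqn (X i) 0 <= rX.
Hypothesis Y_bounded : forall j, j \in J -> sqn (Y j) 0 <= B.

Lemma calibrated_anchored : anchored (pjoint X sig) Y
  (expR (- (4 * rX * (4 * ln (4 / theta) / r))) / 2) theta B J.
Proof.
split=> // i j jJ ji; set c := expR _.
have dist : sqn (X j) (X i) <= 4 * rX.
  have := sqn_le2 (X j) 0 (X i); rewrite [sqn 0 _]sqnC.
  by have := X_bounded i; have := X_bounded j; lra.
have := pcond_ge ji (near_precision_le jJ) dist; rewrite -/c => cji.
rewrite pjointE ler_pdivlMr ?mulr_gt0//.
have -> : c / 2 / n%:R ^+ 2 * (2 * n%:R) = c / n%:R.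
  by field; exact: lt0r_neq0.
by rewrite ler_wpDr ?pcond_ge0.
Qed.

End Calibration.

Section BorelSets.
Context {R : realType} {T : ptopologicalType}.
Implicit Types g : T -> R.

Lemma open_borel (U : set T) : open U -> measurable (U : set (borel_type T)).
Proof. exact: sub_sigma_algebra. Qed.

Lemma continuous_borel g :
  continuous g -> measurable_fun setT (g : borel_type T -> R).
Proof.
move=> /continuousP cg; apply: (measurability _ (RGenOpens.measurableE R)).
move=> _ [_ [a [b ->] <-]]; rewrite setTI; apply: open_borel.
by apply: cg; exact: interval_open.
Qed.

Lemma open_gt_continuous g (a : R) : continuous g -> open [set z | a < g z].
Proof.
by move=> /continuousP cg; apply: (cg [set r | a < r]); exact: open_gt.
Qed.

Lemma borel_gt g (a : R) :
  continuous g -> measurable ([set z | a < g z] : set (borel_type T)).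
Proof. by move=> cg; apply: open_borel; exact: open_gt_continuous. Qed.

Lemma borel_ge g (b : R) :
  continuous g -> measurable ([set z | b <= g z] : set (borel_type T)).
Proof.
move=> /continuous_borel mg.
have := mg measurableT _ (measurable_itv `[b, +oo[); rewrite setTI.
by congr measurable; apply/seteqP; split => z /=; rewrite in_itv /= andbT.
Qed.

Lemma msupport_closed (mu : set (borel_type T) -> \bar R) :
  closed (msupport mu).
Proof.
rewrite -[msupport mu]setCK; apply: open_closedC; rewrite openE => z.
move=> /existsNP[U /not_implyP[oU /not_implyP[Uz U0]]].
apply: (filterS _ (open_nbhs_nbhs (conj oU Uz))) => y Uy yS.
by apply: U0; exact: yS.
Qed.

End BorelSets.

Lemma distribution_tight {disp} {T : measurableType disp} {R : realType}
    (mu : probability T R) (g : T -> R) (e : R) :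
  measurable_fun setT g -> 0 < e ->
  exists t : R, (mu [set z | (t < g z)%R] < e%:E)%E.
Proof.
move=> mg e0.
pose X : {RV mu >-> R} := HB.pack g (isMeasurableFun.Build _ _ _ _ g mg).
have e0' : (0 < e%:E)%E by rewrite lte_fin.
have [t [_ tX]] := cvg_ccdfy0 X (open_ereal_lt' e0').
exists (t + 1); have := tX (t + 1); rewrite /= ltrDl ltr01 => /(_ isT).
congr (_ < _)%E; rewrite /ccdf /distribution /pushforward; congr (mu _).
by apply/seteqP; split => z /=; rewrite in_itv /= andbT.
Qed.

Section WeakConvergence.
Context {R : realType} {T : ptopologicalType}.
Implicit Types g : T -> R.

Definition ramp (a b x : R) : R := Num.min 1 (Num.max 0 ((x - a) / (b - a))).

Lemma ramp_ge0 a b x : 0 <= ramp a b x.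
Proof. by rewrite /ramp le_min ler01 le_max lexx. Qed.

Lemma ramp_le1 a b x : ramp a b x <= 1.
Proof. by rewrite /ramp ge_min lexx. Qed.

Lemma ramp_eq1 a b x : a < b -> b <= x -> ramp a b x = 1.
Proof.
move=> ab bx; apply/min_idPl; rewrite le_max; apply/orP; right.
by rewrite ler_pdivlMr ?subr_gt0// mul1r lerD2r.
Qed.

Lemma ramp_eq0 a b x : a < b -> x <= a -> ramp a b x = 0.
Proof.
move=> ab xa; rewrite /ramp (max_idPl _) ?min_r//.
by rewrite ler_pdivrMr ?subr_gt0// mul0r subr_le0.
Qed.

Lemma continuous_ramp g a b : continuous g -> continuous (ramp a b \o g).
Proof.
move=> cg x.
apply: (@continuous_min _ _ (fun=> 1) _ x); first exact: cst_continuous.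
apply: (@continuous_max _ _ (fun=> 0) _ x); first exact: cst_continuous.
apply: (@continuousM _ _ (fun z => g z - a) (fun=> (b - a)^-1)).
  by apply: continuousB; [exact: cg|exact: cst_continuous].
exact: cst_continuous.
Qed.

Section Ramp.
Variables (mu : {measure set (borel_type T) -> \bar R}) (g : T -> R) (a b : R).
Hypotheses (cg : continuous g) (ab : a < b).

Let ramp_g : borel_type T -> R := fun z => ramp a b (g z).

Let measurable_ramp_g : measurable_fun setT ramp_g.
Proof. exact: (continuous_borel (continuous_ramp cg)). Qed.

Lemma le_integral_ramp :
  (mu [set z | (b <= g z)%R] <= \int[mu]_z (ramp a b (g z))%:E)%E.
Proof.
have mb := @borel_ge _ _ g b cg.
rewrite -[X in (mu X <= _)%E]setIT -integral_indic//.
apply: ge0_le_integral => //.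
- by apply/measurable_EFinP; exact: measurable_indic.
- exact/measurable_EFinP.
move=> z _; rewrite lee_fin indicE; have [bz|zb] := leP b (g z).
  by rewrite mem_set// ramp_eq1.
by rewrite memNset ?ramp_ge0//= leNgt zb.
Qed.

Lemma integral_ramp_le :
  (\int[mu]_z (ramp a b (g z))%:E <= mu [set z | (a < g z)%R])%E.
Proof.
have ma := @borel_gt _ _ g a cg.
rewrite -[X in (_ <= mu X)%E]setIT -integral_indic//.
apply: ge0_le_integral => //.
- by move=> z _; rewrite lee_fin ramp_ge0.
- exact/measurable_EFinP.
- by apply/measurable_EFinP; exact: measurable_indic.
move=> z _; rewrite lee_fin indicE; have [za|az] := leP (g z) a.
  by rewrite ramp_eq0.
by rewrite mem_set// ramp_le1.
Qed.

End Ramp.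

Variable mus : nat -> {measure set (borel_type T) -> \bar R}.
Variable mu : {measure set (borel_type T) -> \bar R}.
Hypothesis cvg_mu : weak_cvg mus mu.

Lemma weak_cvg_ramp g a b : continuous g ->
  (\int[mus k]_z (ramp a b (g z))%:E)%E @[k --> \oo] -->
  (\int[mu]_z (ramp a b (g z))%:E)%E.
Proof.
move=> cg; apply: cvg_mu; first exact: continuous_ramp.
by exists 1 => z /=; rewrite ger0_norm ?ramp_ge0 ?ramp_le1.
Qed.

Lemma weak_cvg_gt g a b (c : \bar R) : continuous g -> a < b ->
  (c < mu [set z | (b <= g z)%R])%E ->
  \forall k \near \oo, (c < mus k [set z | (a < g z)%R])%E.
Proof.
move=> cg ab /lt_le_trans/(_ (le_integral_ramp mu cg ab)).
move=> /open_ereal_gt' c_nbhs.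
have : \forall k \near \oo, (c < \int[mus k]_z (ramp a b (g z))%:E)%E.
  exact: weak_cvg_ramp cg _ c_nbhs.
by apply: filterS => k /lt_le_trans; apply; exact: integral_ramp_le.
Qed.

Lemma weak_cvg_lt g a b (c : \bar R) : continuous g -> a < b ->
  (mu [set z | (a < g z)%R] < c)%E ->
  \forall k \near \oo, (mus k [set z | (b <= g z)%R] < c)%E.
Proof.
move=> cg ab /(le_lt_trans (integral_ramp_le mu cg ab)) /open_ereal_lt' c_nbhs.
have : \forall k \near \oo, (\int[mus k]_z (ramp a b (g z))%:E < c)%E.
  exact: weak_cvg_ramp cg _ c_nbhs.
by apply: filterS => k; apply: le_lt_trans; exact: le_integral_ramp.
Qed.

Lemma weak_cvg_msupport_mass g a z : continuous g -> msupport mu z -> a < g z ->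
  exists2 c : R, 0 < c &
    \forall k \near \oo, (c%:E < mus k [set z | (a < g z)%R])%E.
Proof.
move=> cg muz az; pose b := (a + g z) / 2.
have [ab bz] : a < b /\ b < g z by rewrite /b; lra.
have : (0 < mu [set y | (b <= g y)%R])%E.
  apply: (lt_le_trans (muz _ (@open_gt_continuous _ _ g b cg) bz)).
  by rewrite le_measure ?inE//; [exact: borel_gt|exact: borel_ge|move=> y /ltW].
have mass_gt c : (c < mu [set y | (b <= g y)%R])%E -> _ := weak_cvg_gt cg ab.
case: (mu _) mass_gt => [r|//|] // mass_gt mu_gt0; last first.
  by exists 1 => //; apply: mass_gt; rewrite ltry.
by exists (r / 2); [|apply: mass_gt]; move: mu_gt0; rewrite !lte_fin; lra.
Qed.

Lemma weak_cvg_msupport_le g b z : continuous g ->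
  (\forall k \near \oo, mus k [set z | (b < g z)%R] = 0%E) ->
  msupport mu z -> g z <= b.
Proof.
move=> cg null muz; rewrite leNgt; apply/negP.
move=> /(weak_cvg_msupport_mass cg muz)[c c0 /(filterI null)/filter_ex[k [->]]].
by rewrite lte_fin ltNge ltW.
Qed.

End WeakConvergence.

Section Visits.
Context {T : Type}.
Implicit Types (x : nat -> T) (A B : set T).

Definition visits x A (n : nat) : {set 'I_n} := [set i : 'I_n | x i \in A]%SET.

Lemma visitsS x A B (n : nat) :
  A `<=` B -> (#|visits x A n| <= #|visits x B n|)%N.
Proof.
move=> AB; apply/subset_leq_card/fintype.subsetP => i.
by rewrite !finset.in_set => /set_mem Ai; apply/mem_set/AB.
Qed.

End Visits.

Lemma empiricalE {R : realType} {T : ptopologicalType} (n : nat) (x : nat -> T)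
    (A : set T) :
  @empirical R T n x A = (#|visits x A n|%:R / n%:R)%:E.
Proof.
have -> : @empirical R T n x A =
  (n%:R^-1%:E * \sum_(i < n) @dirac _ (borel_type T) (x i) R A)%E by [].
under eq_bigr do rewrite diracE.
rewrite sumEFin -EFinM mulrC -natr_sum -sum1_card.
rewrite [in RHS]big_mkcond; congr (_%:R / _)%:E.
by apply: eq_bigr => i _; rewrite inE; case: (_ \in _).
Qed.

Section SecondCountable.
Context {R : realType}.

Lemma ae_forall_countable {disp} {T : measurableType disp}
    (mu : {measure set T -> \bar R}) {I : Type} (B : set I)
    (Q : I -> T -> Prop) :
  countable B -> (forall i, B i -> {ae mu, forall x, Q i x}) ->
  {ae mu, forall x, forall i, B i -> Q i x}.
Proof.
move=> /pfcard_geP[->|[f]] aeQ; first by apply: aeW => x i [].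
have : {ae mu, forall x, forall n, Q (f n) x}.
  by apply: ae_foralln => n; apply: aeQ; exact: funS.
by apply: filterS => x Qx i /(@surj _ _ _ _ f)[n _ <-]; exact: Qx.
Qed.

Lemma ae_msupport {T : ptopologicalType}
    (mu : {measure set (borel_type T) -> \bar R}) :
  @second_countable T -> {ae mu, forall x, msupport mu x}.
Proof.
move=> [B cB [openB basisB]].
have : {ae mu, forall x, forall U, B U -> mu U = 0%E -> ~ U x}.
  apply: ae_forall_countable => // U /openB/open_borel mU.
  have [U0|U0] := pselect (mu U = 0%E); last by apply: aeW => x /U0.
  by exists U; split=> // x /= /not_implyP[_ /contrapT].
apply: (@filterS _ _ (ae_filter_ringOfSetsType mu)) => x nullx V oV Vx.
have [U [BU Ux] UV] := basisB x V (open_nbhs_nbhs (conj oV Vx)).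
apply: (@lt_le_trans _ _ (mu U)).
  by rewrite lt0e measure_ge0 andbT; apply/eqP => /(nullx U BU); exact.
by rewrite le_measure ?inE//; apply: open_borel => //; exact: openB.
Qed.

Lemma null_point_small_open_nbhs {V : normedModType R}
    (mu : probability (borel_type V) R) (x : V) (e : R) :
  mu [set x] = 0%E -> 0 < e ->
  exists2 U, open_nbhs x U & (mu U < e%:E)%E.
Proof.
move=> x_null e0; pose B n : set (borel_type V) := ball x n.+1%:R^-1.
have mB n : measurable (B n) by apply: open_borel; exact: ball_open.
have capB : \bigcap_n B n = [set x].
  apply/seteqP; split => [y By|y -> n _]; last exact: ballxx.
  apply/esym; rewrite -norm_closeE ball_close => eps.
  have [n _ /(_ n (leqnn n)) /= n_eps] := near_infty_natSinv_lt eps.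
  by apply: le_ball (By n I); exact: ltW.
have cvgB : (mu \o B) n @[n --> \oo] --> 0%E.
  rewrite -x_null -capB; apply: nonincreasing_cvg_mu => //.
  - by rewrite (le_lt_trans (probability_le1 _ _))// ltry.
  - exact: bigcapT_measurable.
  - move=> n m nm; apply/subsetPset; apply: le_ball.
    by rewrite lef_pV2 ?posrE// ler_nat.
have e_nbhs : ereal_nbhs 0%E (fun u : \bar R => (u < e%:E)%E).
  by apply: open_ereal_lt'; rewrite lte_fin.
have /filter_ex[n Bn] : \forall n \near \oo, (mu (B n) < e%:E)%E.
  exact: cvgB e_nbhs.
exists (B n) => //.
by apply: ball_open_nbhs; rewrite invr_gt0.
Qed.

Lemma second_countable_rV (d : nat) : @second_countable 'rV[R]_d.
Proof.
pose rational_ball (i : 'rV[rat]_d * nat) : set 'rV[R]_d :=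
  ball (map_mx ratr i.1 : 'rV[R]_d) i.2.+1%:R^-1.
exists (range rational_ball).
  by apply: sub_countable (card_image_le _ _) _; exact: countableP.
split=> [_ [i _ <-]|x V]; first exact: ball_open.
move=> /nbhs_ballP[e /= e0 eV].
have e2 : 0 < e / 2 by rewrite divr_gt0.
have [n _ /(_ n (leqnn n)) /= ne] := near_infty_natSinv_lt (PosNum e2).
have r_gt0 : 0 < n.+1%:R^-1 :> R by rewrite invr_gt0.
set r := n.+1%:R^-1 in r_gt0 ne.
have /choice[c cx] : forall j, exists q : rat, `|ratr q - x 0 j| < r.
  move=> j; have /rat_in_itvoo[q] : x 0 j - r < x 0 j + r by lra.
  rewrite in_itv /= => /andP[lo hi]; exists q.
  by rewrite ltr_norml; apply/andP; split; lra.
pose y : 'rV[R]_d := map_mx ratr (\row_j c j).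
have yx : ball y r x by split=> // i j; rewrite !mxE ord1; exact: cx.
exists (rational_ball (\row_j c j, n)).
  by split=> //; exists (\row_j c j, n).
move=> v yv; apply: eV; rewrite [e]splitr; apply: (@ball_triangle _ _ y).
  by apply/ball_sym; exact: le_ball (ltW ne) _ yx.
exact: le_ball (ltW ne) _ yv.
Qed.

End SecondCountable.

Section Atoms.
Context {R : realType}.

Lemma lebint0 (d : nat) : lebint (fun _ : 'rV[R]_d => 0%E) = 0%E.
Proof.
elim: d => //= d IH; rewrite -[RHS](integral0 lebesgue_measure setT).
by apply: eq_integral => t _; rewrite IH.
Qed.

Lemma density_no_atom (d : nat) (mu : set (borel_type 'rV[R]_d.+1) -> \bar R)
    (f : 'rV[R]_d.+1 -> R) (x : 'rV[R]_d.+1) :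
  has_density mu f -> mu [set x] = 0%E.
Proof.
move=> [_ ->]; last first.
  rewrite -[X in measurable X]setCK; apply: measurableC.
  apply: open_borel; apply: closed_openC; apply: accessible_closed_set1.
  exact/hausdorff_accessible/norm_hausdorff.
pose slice t := lebint (fun v : 'rV[R]_d =>
  (\1_[set x] (row_mx (const_mx t : 'rV[R]_1) v : 'rV[R]_(1 + d)) *
   f (row_mx (const_mx t : 'rV[R]_1) v : 'rV[R]_(1 + d)))%:E).
transitivity (\int[@lebesgue_measure R]_t slice t)%E; first by [].
rewrite -(integral_set1 slice (x 0 0)) [RHS]integral_mkcond.
apply: eq_integral => t _; rewrite patchE; case: ifPn => //.
rewrite notin_setE /= => tx; rewrite /slice -[RHS](lebint0 d); congr lebint.
apply/funext => v; rewrite indicE memNset ?mul0r// => vx; apply: tx.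
have -> : x 0 0 = row_mx (const_mx t : 'rV[R]_1) v 0 (lshift d 0).
  by rewrite vx; congr (x 0 _); exact: val_inj.
by rewrite row_mxEl mxE.
Qed.

End Atoms.

Lemma measure_bigsetU_le {disp} {T : measurableType disp} {R : realType}
    (mu : {measure set T -> \bar R}) (I : Type) (r : seq I) (Q : pred I)
    (F : I -> set T) :
  (forall i, measurable (F i)) ->
  (mu (\big[setU/set0]_(i <- r | Q i) F i) <= \sum_(i <- r | Q i) mu (F i))%E.
Proof.
move=> mF; elim: r => [|i r IH]; first by rewrite !big_nil measure0.
rewrite !big_cons; case: ifP => // _.
apply: (le_trans (measureU2 _ (mF i) _)); first exact: bigsetU_measurable.
by rewrite leeD2l.
Qed.

Section IidVisits.
Context {R : realType} {disp : measure_display} {Omega : measurableType disp}.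
Variables (P : probability Omega R) (T : ptopologicalType).
Variable X : nat -> Omega -> borel_type T.
Variable mu : probability (borel_type T) R.
Hypothesis mX : forall i, measurable_fun setT (X i).
Hypothesis lawX : forall i (A : set (borel_type T)), measurable A ->
  P (X i @^-1` A) = mu A.

Let measurable_preimage i (A : set (borel_type T)) :
  measurable A -> measurable (X i @^-1` A).
Proof. by rewrite -[X in _ -> measurable X]setTI; exact: mX. Qed.

Lemma ae_in_msupport : @second_countable T ->
  {ae P, forall w, forall i, msupport mu (X i w)}.
Proof.
move=> sT; have [N [mN N0 suppN]] := ae_msupport mu sT.
apply: ae_foralln => i; exists (X i @^-1` N); split.
- exact: measurable_preimage.
- exact: etrans (lawX i mN) N0.
- by move=> w /= Xw; exact: suppN.
Qed.

Hypothesis indX : mutually_independent P X.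

Section Crowded.
Variables (A : set (borel_type T)) (m : nat).
Hypothesis mA : measurable A.
Hypothesis smallA : (mu A <= ((4 ^+ m)^-1)%:E)%E.

Definition all_visit n (S : {set 'I_n}) : set Omega :=
  \big[setI/setT]_(i <- [seq val i | i <- enum S]) (X i @^-1` A).

Lemma measurable_all_visit n (S : {set 'I_n}) : measurable (all_visit S).
Proof. by apply: bigsetI_measurable => i _; exact: measurable_preimage. Qed.

Lemma probability_all_visit n (S : {set 'I_n}) :
  P (all_visit S) = (fine (mu A) ^+ #|S|)%:E.
Proof.
rewrite /all_visit indX//; last first.
  by rewrite map_inj_uniq ?enum_uniq//; exact: val_inj.
rewrite (eq_bigr (fun=> (fine (mu A))%:E)); last first.
  by move=> i _; rewrite lawX// fineK// fin_num_measure.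
by rewrite prodEFin big_const_seq count_predT size_map -cardE iter_mulr_1.
Qed.

Definition crowded n : set Omega :=
  \big[setU/set0]_(S : {set 'I_n} | (n <= m * #|S|)%N) all_visit S.

Lemma measurable_crowded n : measurable (crowded n).
Proof. by apply: bigsetU_measurable => S _; exact: measurable_all_visit. Qed.

Lemma visits_crowded n w :
  (n <= m * #|visits (fun i => X i w) A n|)%N -> crowded n w.
Proof.
set S := visits _ A n => nS; rewrite /crowded (bigD1 S) //=; left.
have : all [in S] (enum S) by apply/allP => i; rewrite mem_enum.
rewrite /all_visit; elim: (enum S) => [|i r IH] /=; first by rewrite big_nil.
rewrite big_cons => /andP[iS rS]; split; last exact: IH.
by move: iS; rewrite finset.in_set => /set_mem.
Qed.

(* Union bound over the [2 ^ n] index sets, each of probability at most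
   [4 ^ - n]. *)
Lemma probability_crowded_le n : (P (crowded n) <= (2 / (2 ^ n.+1)%:R)%:E)%E.
Proof.
apply: le_trans (measure_bigsetU_le P _ _ (@measurable_all_visit n)) _.
have a_le : fine (mu A) <= (4 ^+ m)^-1.
  by rewrite -lee_fin fineK// fin_num_measure.
apply: (@le_trans _ _ (\sum_(S : {set 'I_n}) ((4 ^+ n)^-1)%:E)%E).
  rewrite big_mkcond /=; apply: lee_sum => S _; case: ifP => [nS|_]; last first.
    by rewrite lee_fin invr_ge0 exprn_ge0.
  rewrite probability_all_visit lee_fin.
  apply: (@le_trans _ _ ((4 ^+ m)^-1 ^+ #|S|)).
    by rewrite lerXn2r ?nnegrE ?invr_ge0 ?exprn_ge0 ?fine_ge0.
  by rewrite exprVn -exprM lef_pV2 ?posrE ?exprn_gt0// ler_weXn2l// ler1n.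
rewrite sumEFin lee_fin sumr_const -cardsT -powersetT card_powerset.
rewrite cardsT card_ord -[leLHS]mulr_natl !natrX.
rewrite (_ : 4 = 2 * 2 :> R); last by ring.
by rewrite exprMn exprS !invfM !mulrA !divff ?mul1r// ?expf_neq0// pnatr_eq0.
Qed.

Lemma ae_visits_lt :
  {ae P, forall w,
    \forall n \near \oo, (m * #|visits (fun i => X i w) A n| < n)%N}.
Proof.
exists (lim_sup_set crowded); split.
- by apply: bigcapT_measurable => n; apply: bigcup_measurable => k _;
    exact: measurable_crowded.
- apply: lim_sup_set_cvg0; first exact: measurable_crowded.
  apply: (@le_lt_trans _ _ 2%:E); last by rewrite ltry.
  apply: le_trans (epsilon_trick0 xpredT (ler0n R 2)).
  by apply: lee_nneseries => // n _; exact: probability_crowded_le.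
move=> w /= often n _; apply: contrapT => rare; apply: often.
exists n => // k /= nk; rewrite ltnNge; apply/negP => /visits_crowded cw.
by apply: rare; exists k.
Qed.

End Crowded.
End IidVisits.

Definition locally_thin {T : topologicalType} (m : nat) (x : nat -> T) : Prop :=
  forall z : T, exists2 U, nbhs z U &
    \forall n \near \oo, (m * #|visits x U n| < n)%N.

Lemma ae_locally_thin {R : realType} {disp} {Omega : measurableType disp}
    (P : probability Omega R) (V : normedModType R)
    (X : nat -> Omega -> borel_type V) (mu : probability (borel_type V) R)
    (m : nat) :
  (forall i, measurable_fun setT (X i)) ->
  (forall i (A : set (borel_type V)), measurable A -> P (X i @^-1` A) = mu A) ->
  mutually_independent P X ->
  @second_countable V -> (forall x, mu [set x] = 0%E) ->
  {ae P, forall w, @locally_thin V m (fun i => X i w)}.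
Proof.
move=> mX lawX indX [B cB [openB basisB]] no_atom.
have : {ae P, forall w, forall U, B U -> (mu U <= ((4 ^+ m)^-1)%:E)%E ->
    \forall n \near \oo, (m * #|visits (fun i => X i w) U n| < n)%N}.
  apply: ae_forall_countable => // U /openB/open_borel mU.
  have [smallU|bigU] := pselect (mu U <= ((4 ^+ m)^-1)%:E)%E; last first.
    by apply: aeW => w /bigU.
  by have := ae_visits_lt mX lawX indX mU smallU; apply: filterS => w.
apply: filterS => w thin z.
have m0 : 0 < (4 ^+ m)^-1 :> R by rewrite invr_gt0 exprn_gt0.
have [W oWz small] := null_point_small_open_nbhs (no_atom z) m0.
have [U [BU Uz] UW] := basisB z W (open_nbhs_nbhs oWz).
exists U; first by apply: open_nbhs_nbhs; split => //; exact: openB.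
apply: thin => //; apply/ltW/(le_lt_trans _ small).
by rewrite le_measure ?inE//; apply: open_borel; [exact: openB|case: oWz].
Qed.

Section SqnTopology.
Context {R : realType} {k : nat}.

Lemma continuous_sqn {T : topologicalType} (f : T -> 'rV[R]_k) (y : 'rV[R]_k) :
  continuous f -> continuous (fun z => sqn (f z) y).
Proof.
move=> cf; apply: continuous_big => [|i _ z]; first exact: add_continuous.
have ci : {for z, continuous (fun z => f z 0 i - y 0 i)}.
  apply: continuousB; last exact: cst_continuous.
  apply: (@continuous_comp _ _ _ f (fun v => v 0 i)); first exact: cf.
  exact: coord_continuous.
exact: (continuousM ci ci).
Qed.

Lemma nbhs_sqn (x : 'rV[R]_k) (U : set 'rV[R]_k) : nbhs x U ->
  exists2 e : R, 0 < e & [set y | sqn y x < e] `<=` U.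
Proof.
move=> /nbhs_ballP[e e0 eU]; exists (e ^+ 2); first exact: exprn_gt0.
move=> y /= yx; apply: eU; apply: ball_sym.
split=> // i j; rewrite ord1 /ball /=.
have := le_lt_trans (coord_sqr_le_sqn y x j) yx.
by rewrite -[X in X < _]real_normK ?num_real// ltr_pXn2r// nnegrE ltW.
Qed.

Lemma compact_sqn_ball (T : R) : compact [set v : 'rV[R]_k | sqn v 0 <= T].
Proof.
apply: bounded_closed_compact.
  exists (T + 1); split; first exact: num_real.
  move=> M TM v /= vT; rewrite [leLHS]/Num.norm /= mx_normrE.
  have T0 : 0 <= T := le_trans (sqn_ge0 v 0) vT.
  apply/bigmax_leP; split=> [|[i j] _ /=]; first by lra.
  rewrite ord1 (le_trans _ (ltW TM))//.
  have := le_trans (coord_sqr_le_sqn v 0 j) vT.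
  rewrite mxE subr0 -real_normK ?num_real//.
  by have := sqr_ge0 (`|v 0 j| - 1); lra.
apply: (@closed_comp _ _ (fun v : 'rV[R]_k => sqn v 0) [set r | r <= T]).
  by move=> v _; apply: continuous_sqn => z; exact: cvg_id.
exact: closed_le.
Qed.

End SqnTopology.

Section LimitOfMinimizers.
Context {R : realType} {d s : nat}.
Variables (rho : R) (m : nat) (x : nat -> 'rV[R]_d) (rX : R).
Hypotheses (rho01 : 0 < rho < 1) (m_rho : 4 <= m%:R * rho ^+ 2).
Hypothesis x_bounded : forall j, sqn (x j) 0 <= rX.
Hypothesis x_thin : locally_thin m x.
Variables (sig : forall n : nat, 'I_n -> R) (Y : nat -> nat -> 'rV[R]_s).
Variables (nk : nat -> nat) (mu : probability (BT R d s) R).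
Hypothesis nk_incr : forall k, (nk k < nk k.+1)%N.
Hypothesis nk_ge2 : forall k, (2 <= nk k)%N.
Hypothesis cal : forall k,
  calibrated rho (fun i : 'I_(nk k) => x i) (@sig (nk k)).
Hypothesis minY : forall k,
  is_tsne_minimizer (fun i : 'I_(nk k) => x i) (@sig (nk k))
    (fun i : 'I_(nk k) => Y (nk k) i).

Let points k (i : nat) : 'rV[R]_d * 'rV[R]_s := (x i, Y (nk k) i).

Hypothesis cvg_mu : weak_cvg (fun k => @empirical R _ (nk k) (points k)) mu.

Let nk_gt0 k : 0 < (nk k)%:R :> R.
Proof. by rewrite ltr0n; exact: leq_trans (nk_ge2 k). Qed.

Let nk_large n0 : \forall k \near \oo, (n0 <= nk k)%N.
Proof.
have nk_ge k : (k <= nk k)%N.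
  by elim: k => // k IH; exact: leq_ltn_trans (nk_incr k).
by exists n0 => // k /= n0k; exact: leq_trans (nk_ge k).
Qed.

Let continuous_sqn1 (x0 : 'rV[R]_d) :
  continuous (fun z : 'rV[R]_d * 'rV[R]_s => sqn z.1 x0).
Proof. by apply: continuous_sqn => z; exact: cvg_fst. Qed.

Let continuous_sqn2 (y0 : 'rV[R]_s) :
  continuous (fun z : 'rV[R]_d * 'rV[R]_s => sqn z.2 y0).
Proof. by apply: continuous_sqn => z; exact: cvg_snd. Qed.

Lemma visits_near_msupport x0 y0 (eta : R) : msupport mu (x0, y0) -> 0 < eta ->
  exists2 theta : R, 0 < theta & \forall k \near \oo, theta * (nk k)%:R <=
    #|visits (points k) [set z | sqn z.1 x0 < eta /\ sqn z.2 y0 < 1] (nk k)|%:R.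
Proof.
move=> mu0 eta0.
pose g (z : 'rV[R]_d * 'rV[R]_s) := Num.min (eta - sqn z.1 x0) (1 - sqn z.2 y0).
have cg : continuous g.
  move=> z; apply: (@continuous_min _ _ (fun z => eta - sqn z.1 x0)
    (fun z => 1 - sqn z.2 y0)); apply: continuousB.
  - exact: cst_continuous.
  - exact: continuous_sqn1.
  - exact: cst_continuous.
  - exact: continuous_sqn2.
have g0 : 0 < g (x0, y0) by rewrite /g /= !sqnn !subr0 lt_min eta0 ltr01.
have [theta theta0 mass] := weak_cvg_msupport_mass cvg_mu cg mu0 g0.
exists theta => //; apply: filterS mass => k; rewrite empiricalE lte_fin.
rewrite ltr_pdivlMr// => /ltW/le_trans; apply.
rewrite ler_nat visitsS// => z /=.
by rewrite lt_min !subr_gt0 => /andP[].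
Qed.

Lemma tail_eventually_small (eps : R) : 0 < eps ->
  exists T : R,
    \forall k \near \oo, tail (fun i : 'I_(nk k) => Y (nk k) i) T <= eps.
Proof.
move=> eps0; have mg := continuous_borel (@continuous_sqn2 0).
have [T small] := distribution_tight mu mg eps0.
exists (T + 1); have T_lt : T < T + 1 by rewrite ltrDl.
apply: filterS (weak_cvg_lt cvg_mu (@continuous_sqn2 0) T_lt small) => k.
rewrite empiricalE lte_fin => /ltW; apply: le_trans.
rewrite /tail ler_wpM2r ?invr_ge0// ler_nat subset_leq_card//.
by apply/fintype.subsetP => i; rewrite !finset.in_set => Ti; exact: mem_set.
Qed.

Lemma embedding_eventually_bounded z0 : msupport mu z0 ->
  exists radius : R,
    \forall k \near \oo, forall i : 'I_(nk k), sqn (Y (nk k) i) 0 <= radius.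
Proof.
case: z0 => x0 y0 mu0.
have [U /nbhs_sqn[r r0 rU] [n0 _ thinU]] := x_thin x0.
have r20 : 0 < r / 20 by rewrite divr_gt0.
have [theta theta0 many] := visits_near_msupport mu0 r20.
pose c := expR (- (4 * rX * (4 * ln (4 / theta) / r))) / 2.
pose B := 2 + 2 * sqn y0 0.
have c0 : 0 < c by rewrite divr_gt0 ?expR_gt0.
have B1 : 1 <= B by have := sqn_ge0 y0 0; rewrite /B; lra.
have [eps eps0 bounded] := anchored_embedding_bounded c0 theta0 B1.
have [T tails] := tail_eventually_small eps0.
have [radius radiusP] := bounded T; exists radius; near=> k.
have n_large : 2 <= theta * (nk k)%:R.
  rewrite mulrC -ler_pdivrMr//.
  have : (Num.bound (2 / theta) <= nk k)%N by near: k; exact: nk_large.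
  rewrite -(ler_nat R); apply: le_trans; apply/ltW/archi_boundP.
  by rewrite divr_ge0// ltW.
have U_small : (m * #|visits x U (nk k)| <= nk k)%N.
  by apply/ltnW/thinU; near: k; exact: nk_large.
have tail_small : tail (fun i : 'I_(nk k) => Y (nk k) i) T <= eps.
  by near: k; exact: tails.
have : theta * (nk k)%:R <= #|visits (points k)
    [set z | sqn z.1 x0 < r / 20 /\ sqn z.2 y0 < 1] (nk k)|%:R.
  by near: k; exact: many.
set J := visits _ _ _ => J_large.
have nearJ (j : 'I_(nk k)) :
    j \in J -> sqn (x j) x0 < r / 20 /\ sqn (Y (nk k) j) y0 < 1.
  by rewrite finset.in_set => /set_mem.
have U_far (j : 'I_(nk k)) : j \notin visits x U (nk k) -> r <= sqn (x j) x0.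
  rewrite finset.in_set leNgt; apply: contraNN => jr; apply/mem_set; exact: rU.
apply: (radiusP _ _ (pjoint (fun i : 'I_(nk k) => x i) (@sig (nk k)))
  (fun i => Y (nk k) i) J) => //.
- by move=> i j; exact: pjoint_ge0.
- apply: (calibrated_anchored (nk_ge2 k) rho01 m_rho (@cal k) r0 U_small
    U_far) => //.
  + by move=> j /nearJ[/ltW].
  + move=> j /nearJ[_ jy]; have := sqn_le2 (Y (nk k) j) y0 0.
    by rewrite /B; lra.
- by move=> h; apply: tsne_minimizer_stationary (nk_ge2 k) (@minY k).
Unshelve. all: by end_near. Qed.

Lemma limit_msupport_le (g : 'rV[R]_d * 'rV[R]_s -> R) (b : R) :
  continuous g ->
  (\forall k \near \oo, forall i : 'I_(nk k), g (points k i) <= b) ->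
  msupport mu `<=` [set z | g z <= b].
Proof.
move=> cg gb z /=; apply: (weak_cvg_msupport_le cvg_mu cg).
apply: filterS gb => k gk.
rewrite empiricalE (_ : visits _ _ _ = finset.set0); last first.
  apply/finset.setP => i; rewrite finset.in_set finset.in_set0; apply/negbTE.
  by rewrite notin_setE /= ltNge; apply/negP; rewrite negbK.
by rewrite cards0 mul0r.
Qed.

Lemma limit_msupport_compact : compact (msupport mu).
Proof.
have [->|/set0P[z0 muz0]] := eqVneq (msupport mu) set0; first exact: compact0.
have [radius Y_bounded] := embedding_eventually_bounded muz0.
have x_le : \forall k \near \oo, forall i : 'I_(nk k), sqn (x i) 0 <= rX.
  by apply: nearW => k i; exact: x_bounded.
have data_le := limit_msupport_le (@continuous_sqn1 0) x_le.
have embedding_le := limit_msupport_le (@continuous_sqn2 0) Y_bounded.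
have cK :=
  compact_setX (@compact_sqn_ball R d rX) (@compact_sqn_ball R s radius).
apply: subclosed_compact (@msupport_closed _ _ mu) cK _ => z muz.
by split; [exact: data_le|exact: embedding_le].
Qed.

End LimitOfMinimizers.

Lemma compact_sqn_bounded {R : realType} {d : nat} (A : set 'rV[R]_d) :
  compact A -> exists M : R, forall x, A x -> sqn x 0 <= M.
Proof.
move=> cA; have : compact ((fun x => sqn x 0) @` A).
  apply: continuous_compact => //; apply: continuous_subspaceT.
  by apply: continuous_sqn => z; exact: cvg_id.
move=> /compact_bounded[M [_ MP]]; exists (M + 1) => x Ax.
have := MP (M + 1); rewrite ltrDl ltr01 => /(_ isT (sqn x 0)).
by rewrite /= ger0_norm ?sqn_ge0//; apply; exists x.
Qed.

Theorem theorem1p2 (R : realType) (d s : nat) (rho : R)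
  (muX : probability (borel_type 'rV[R]_d) R) (fX : 'rV[R]_d -> R)
  (dO : measure_display) (Omega : measurableType dO) (P : probability Omega R)
  (X : nat -> Omega -> borel_type 'rV[R]_d) :
  (2 <= d)%N -> (2 <= s)%N -> 0 < rho < 1 ->
  has_density muX fX -> C1 fX -> compact (msupport muX) ->
  (forall i, measurable_fun setT (X i)) ->
  mutually_independent P X ->
  (forall i (A : set (borel_type 'rV[R]_d)), measurable A ->
     P (X i @^-1` A) = muX A) ->
  {ae P, forall omega : Omega,
    forall (sig : forall n : nat, 'I_n -> R)
           (Ystar : nat -> nat -> 'rV[R]_s)
           (nk : nat -> nat) (mustar : probability (BT R d s) R),
      (forall k, (nk k < nk k.+1)%N) ->
      (forall k, (2 <= nk k)%N /\
         calibrated rho (fun i : 'I_(nk k) => X i omega) (sig (nk k)) /\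
         is_tsne_minimizer (fun i : 'I_(nk k) => X i omega) (sig (nk k))
           (fun i : 'I_(nk k) => Ystar (nk k) i)) ->
      weak_cvg (fun k => @empirical R _ (nk k)
                  (fun i : nat => ((X i omega, Ystar (nk k) i)
                                   : BT R d s)))
               mustar ->
      Irho rho mustar =
        ereal_inf [set Irho rho mu | mu in [set mu : probability (BT R d s) R
                                             | in_PtX rho muX mu]] ->
      compact (msupport mustar)}.
Proof.
case: d muX fX X => // d muX fX X _ _ rho01 dens _ compX mX indX lawX.
have [m m_rho] : exists m : nat, 4 <= m%:R * rho ^+ 2.
  have /andP[rho0 _] := rho01; exists (Num.bound (4 / rho ^+ 2)).
  by rewrite -ler_pdivrMr ?exprn_gt0// ltW// archi_boundP// divr_ge0// sqr_ge0.
have [rX suppX_le] := compact_sqn_bounded compX.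
have countable_basis := @second_countable_rV R d.+1.
have no_atom x := density_no_atom x dens.
have in_supp := ae_in_msupport mX lawX countable_basis.
have thin := ae_locally_thin m mX lawX indX countable_basis no_atom.
apply: filterS2 in_supp thin => w in_supp thin sig Ystar nk mustar nk_incr.
move=> minimizers weak _; apply: (limit_msupport_compact (sig := sig) rho01
  m_rho _ thin nk_incr _ _ _ weak) => k.
- exact/suppX_le/in_supp.
- by case: (minimizers k).
- by case: (minimizers k) => _ [].
- by case: (minimizers k) => _ [].
Qed.
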